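(* The restrictions of $X_0:\mathcal{A}\to\mathbb{C}[p_1,p_2,\dots]$ to the rotational Hopf algebra of positive permutations $\mathcal{A}^+\subset\mathcal{A}$ and to the rotational Hopf algebra of chord diagrams $\mathcal{B}\subset\mathcal{A}$ are filtered Hopf algebra homomorphisms. Moreover, if $\alpha$ is a positive permutation (in particular, if $\alpha$ is an involution without fixed points, that is, a chord diagram), then under the substitution $p_m:=x$, $m=1,2,\dots$, the polynomial $X_0(\alpha)$ becomes the chromatic polynomial $\chi_{\gamma(\alpha)}(x)$ of the intersection graph $\gamma(\alpha)$.
   Context: **The weight system $w_{\mathfrak{gl}}$.** For $\alpha\in\mathbb{S}_m$ (the symmetric group on $\{1,\dots,m\}$) and $N\ge1$ let $w_{\mathfrak{gl}(N)}(\alpha)=\sum_{i_1,\dots,i_m=1}^N E_{i_1,i_{\alpha(1)}}\cdots E_{i_m,i_{\alpha(m)}}\in U\mathfrak{gl}(N)$, where $E_{i,j}$ are the matrix units; put $C_m=w_{\mathfrak{gl}(N)}((1,2,\dots,m))$, with $(1,2,\dots,m)$ the standard cycle $1\mapsto2\mapsto\dots\mapsto m\mapsto1$. Then $w_{\mathfrak{gl}}(\alpha)\in\mathbb{C}[N,C_1,C_2,\dots]$ is the unique polynomial which specializes to $w_{\mathfrak{gl}(N)}(\alpha)$ for every positive integer $N$ (with $C_k$ replaced by the element $w_{\mathfrak{gl}(N)}((1,2,\dots,k))\in U\mathfrak{gl}(N)$, $k=1,2,\dots$). Equivalently (a known theorem of Zhuoke Yang), $w_{\mathfrak{gl}}$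 is the unique function on permutations with the following properties: it equals $1$ on the empty permutation; it is invariant under conjugation by the standard long cycle; it is multiplicative for concatenation; it takes value $C_m$ on the standard $m$-cycle; and for $1\le\ell<m$, with $\tau=(\ell\ \ell{+}1)$ and $\alpha'=\tau\alpha\tau$: (i) if $\alpha(\ell)\ne\ell+1$ and $\alpha(\ell+1)\neq\ell$, then $w_{\mathfrak{gl}}(\alpha)=w_{\mathfrak{gl}}(\alpha')+w_{\mathfrak{gl}}(\beta_1)-w_{\mathfrak{gl}}(\beta_2)$, where $\beta_1$, $\beta_2$ are the restrictions (defined below) of $\alpha\circ\tau$ ($\tau$ applied first) to $\{1,\dots,m\}\setminus\{\ell+1\}$ and $\{1,\dots,m\}\setminus\{\ell\}$ respectively; (ii) if $\alpha(\ell+1)=\ell$ and $\alpha(\ell)\ne\ell+1$, then $w_{\mathfrak{gl}}(\alpha)=w_{\mathfrak{gl}}(\alpha')+C_1 w_{\mathfrak{gl}}(\alpha|_{\{1,\dots,m\}\setminus\{\ell,\ell+1\}})-N w_{\mathfrak{gl}}(\alpha|_{\{1,\dots,m\}\setminus\{\ell\}})$. **Restriction.** For $U\subset\{1,\dots,m\}$, $\alpha|_U\in\mathbb{S}_{|U|}$ is obtained by deleting from the disjoint cycles of $\alpha$ all elements not in $U$ (keeping the cyclic order of the remaining ones in each cycle) and renumbering $U$ increasingly by $1,\dots,|U|$. $V(\alpha)$ is the set of disjoint cycles of $\alpha$ (fixed points included), $c(\alpha)=|V(\alpha)|$; for $I\subset V(\alpha)$, $\alpha|_I$ is the restriction of $\alpha$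 to the set of elements contained in the cycles from $I$. **Prechromatic invariant.** $X(\alpha)=N^{c(\alpha)-m}\,w_{\mathfrak{gl}}(\alpha)|_{C_k:=p_kN^{k-1},\,k=1,2,\dots}$. It is a polynomial in $N^{-2},p_1,p_2,\dots$, written $X(\alpha)=X_0(\alpha)+N^{-2}X_1(\alpha)+N^{-4}X_2(\alpha)+\dots$ with $X_k(\alpha)\in\mathbb{C}[p_1,p_2,\dots]$. **The Hopf algebra $\mathcal{A}$.** The concatenation $\alpha_1\#\alpha_2\in\mathbb{S}_{m_1+m_2}$ of $\alpha_1\in\mathbb{S}_{m_1}$, $\alpha_2\in\mathbb{S}_{m_2}$ acts as $\alpha_1$ on $\{1,\dots,m_1\}$ and as the shifted $\alpha_2$ on $\{m_1+1,\dots,m_1+m_2\}$. Consider the equivalence relation on permutations generated by: $\alpha\sim\sigma^{-1}\alpha\sigma$ with $\sigma=(1,2,\dots,m)$, $\alpha\in\mathbb{S}_m$; and $\alpha_1\#\alpha_2\sim\alpha_1'\#\alpha_2'$ whenever $\alpha_i'$ is (cyclically) equivalent to $\alpha_i$, $i=1,2$. Let $\mathcal{A}_m$ be the $\mathbb{C}$-vector space freely spanned by the equivalence classes $[\alpha]$, $\alpha\in\mathbb{S}_m$, and $\mathcal{A}=\bigoplus_{m\ge0}\mathcal{A}_m$. With multiplication induced by $\#$ and comultiplication $\mu([\alpha])=\sum_{I\sqcup J=V(\alpha)}[\alpha|_I]\otimes[\alpha|_J]$ (sum over ordered partitions of $V(\alpha)$ into two disjoint subsets), $\mathcal{A}$ is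 a graded connected commutative cocommutative Hopf algebra, filtered by the subspaces $\mathcal{A}_0\oplus\dots\oplus\mathcal{A}_m$. The map $X_0$ on $\mathcal{A}$ is the linear extension of $[\alpha]\mapsto X_0(\alpha)$. **The target.** $\mathbb{C}[p_1,p_2,\dots]$ has the usual multiplication and the comultiplication determined by $p_m\mapsto 1\otimes p_m+p_m\otimes1$; it is filtered by weighted degree, where $p_m$ has degree $m$. A homomorphism is filtered if it maps the $m$-th term of the filtration to the $m$-th term for all $m$. **Positive permutations.** An ascent of $\alpha\in\mathbb{S}_m$ is a number $i$, $0<i<m$, with $\alpha(i)>i$; $a(\alpha)$ is the number of ascents. $\alpha\in\mathbb{S}_m$ is positive if $a(\alpha)=m-c(\alpha)$; equivalently, the restriction of $\alpha$ to each of its disjoint cycles is a standard cycle. Every involution is positive. $\mathcal{A}^+\subset\mathcal{A}$ is the graded Hopf subalgebra spanned by the classes of positive permutations, and $\mathcal{B}\subset\mathcal{A}^+$ is the graded Hopf subalgebra spanned by the classes of involutions without fixed points (chord diagrams); both carry the induced filtration. **Intersection graph.** Two disjoint cycles of $\alpha$ interlace if there are two elements $a,a'$ of one and two elements $b,b'$ of the other with $a<b<a'<b'$ or $b<a<b'<a'$. The intersection graph $\gamma(\alpha)$ is the simple graph with vertex set $V(\alpha)$ in which two vertices are adjacent iff the corresponding cycles interlace. *)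

(* Defs.v *)
From HB Require Import structures.
From mathcomp Require Import all_boot all_order all_algebra all_fingroup.
From mathcomp Require Import generic_quotient boolp reals complex.
From mathcomp Require Import finmap monalg.
Set Implicit Arguments.
Unset Strict Implicit.
Unset Printing Implicit Defensive.
Import GRing.Theory.
Local Open Scope ring_scope.
Local Open Scope quotient_scope.

(* {1, ..., m} is encoded throughout as 'I_m = {0, ..., m - 1}. *)

Section Permutations.

(* i |-> i + 1 mod m *)
Definition long_cycle (m : nat) : 'S_m := perm (@ordS_inj m).

Definition cat_fun m n (a : 'S_m) (b : 'S_n) (i : 'I_(m + n)) : 'I_(m + n) :=
  unsplit (match split i with inl j => inl (a j) | inr k => inr (b k) end).

Lemma cat_fun_inj m n (a : 'S_m) (b : 'S_n) : injective (cat_fun a b).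
Proof.
move=> i j /(can_inj (@unsplitK m n)) H; apply: (can_inj (@splitK m n)).
by case: (split i) (split j) H => [i'|i'] [j'|j'] // [/perm_inj->].
Qed.

Definition cat_perm m n (a : 'S_m) (b : 'S_n) : 'S_(m + n) :=
  perm (@cat_fun_inj m n a b).

Section Restriction.
Variables (m : nat) (a : 'S_m) (U : {set 'I_m}).

(* For x in U: the first element of U met among a x, a (a x), ... *)
Definition return_time (x : 'I_m) : nat :=
  find (fun k => iter k.+1 a x \in U) (iota 0 m).
Definition first_return (x : 'I_m) : 'I_m := iter (return_time x).+1 a x.

Lemma iter_perm_inj n : injective (iter n a).
Proof. by elim: n => [|n IH] x y //= /perm_inj/IH. Qed.

Lemma return_timeP x : x \in U ->
  first_return x \in U /\
  (forall k, (k < return_time x)%N -> iter k.+1 a x \notin U).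
Proof.
move=> xU.
have hasx : has (fun k => iter k.+1 a x \in U) (iota 0 m).
  apply/hasP; exists (#|porbit a x|.-1).
    rewrite mem_iota add0n /=.
    have c0 : (0 < #|porbit a x|)%N by apply/card_gt0P; exists x; apply: porbit_id.
    rewrite prednK //; apply: leq_trans (max_card _) _; by rewrite card_ord.
  have c0 : (0 < #|porbit a x|)%N by apply/card_gt0P; exists x; apply: porbit_id.
  by rewrite prednK // iter_porbit.
have lt_m : (return_time x < m)%N by move: hasx; rewrite has_find size_iota.
split.
  by have := nth_find 0%N hasx; rewrite -/(return_time x) nth_iota // add0n.
move=> k ltk; have := before_find 0%N ltk.
by rewrite nth_iota ?add0n ?(ltn_trans ltk) // => ->.
Qed.

Lemma first_return_inj : {in U &, injective first_return}.
Proof.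
have aux x y : x \in U -> y \in U -> (return_time x <= return_time y)%N ->
    first_return x = first_return y -> x = y.
  move=> xU yU le_xy; rewrite /first_return.
  have -> : (return_time y).+1 =
            ((return_time x).+1 + (return_time y - return_time x))%N.
    by rewrite addSn subnKC.
  rewrite iterD => /(iter_perm_inj).
  case E: (return_time y - return_time x)%N => [//|k] xE.
  have lt_k : (k < return_time y)%N by rewrite -E leq_subr.
  by have [_ /(_ _ lt_k)] := return_timeP yU; rewrite -xE xU.
move=> x y xU yU exy; case/orP: (leq_total (return_time x) (return_time y)) => h.
  exact: aux h exy.
by apply/esym/(aux _ _ yU xU h (esym exy)).
Qed.

Definition restr_fun (i : 'I_#|U|) : 'I_#|U| :=
  enum_rank_in (enum_valP i) (first_return (enum_val i)).

Lemma restr_fun_inj : injective restr_fun.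
Proof.
move=> i j E; apply: enum_val_inj.
have inU k : first_return (@enum_val _ (mem U) k) \in U.
  by have [] := return_timeP (enum_valP k).
apply: first_return_inj; rewrite ?enum_valP //.
have := congr1 (@enum_val _ (mem U)) E.
by rewrite /restr_fun !enum_rankK_in.
Qed.

(* [enum_val : 'I_#|U| -> 'I_m] is increasing, so this is the order-preserving
   renumbering of U. *)
Definition restr : 'S_#|U| := perm restr_fun_inj.

End Restriction.

Definition ascents m (a : 'S_m) : nat := #|[set i : 'I_m | (i < a i)%N]|.

Definition positive m (a : 'S_m) : bool := (ascents a == m - #|porbits a|)%N.

Definition chord_diagram m (a : 'S_m) : bool :=
  [forall i, (a (a i) == i) && (a i != i)].

End Permutations.

Section IntersectionGraph.

Definition interlace m (A B : {set 'I_m}) : bool :=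
  [exists x in A, exists x' in A, exists y in B, exists y' in B,
     [&& x < y, y < x' & x' < y'] || [&& y < x, x < y' & y' < x']]%N.

Definition cycle_of m (a : 'S_m) : finType := {A : {set 'I_m} | A \in porbits a}.

Definition intersection_graph m (a : 'S_m) : rel (cycle_of a) :=
  fun A B => (A != B) && interlace (val A) (val B).

Definition proper_colorings (T : finType) (e : rel T) (n : nat) :
    {set {ffun T -> 'I_n}} :=
  [set f : {ffun T -> 'I_n} | [forall x, forall y, e x y ==> (f x != f y)]].

(* Over a field of characteristic 0 at most one polynomial has this property. *)
Definition is_chromatic_poly (K : fieldType) (T : finType) (e : rel T)
    (p : {poly K}) : Prop :=
  forall n : nat, p.[n%:R] = #|proper_colorings e n|%:R.

End IntersectionGraph.

(* Polynomials in countably many variables: the k-th variable (k : nat) stands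
   for p_(k+1), or for C_(k+1). *)
Notation cpoly K := {malg K[{cmonom nat}]}.

Section CountablePolynomials.
Variable K : fieldType.

Definition pvar (k : nat) : cpoly K := << ucm k >>.

Definition cmonom_eval (S : comNzRingType) (v : nat -> S) (mon : {cmonom nat}) :
  S := \prod_(i <- finsupp mon) v i ^+ mon i.

Definition peval (S : comNzRingType) (f : K -> S) (v : nat -> S) :
  cpoly K -> S := mmap f (cmonom_eval v).

Definition wdeg (mon : {cmonom nat}) : nat :=
  (\sum_(i <- finsupp mon) mon i * i.+1)%N.

Definition cpoly_filt (n : nat) (f : cpoly K) : Prop :=
  forall mon, mon \in msupp f -> (wdeg mon <= n)%N.

End CountablePolynomials.

Section WeightSystem.
Variable K : fieldType.

(* K[N, C_1, C_2, ...] is viewed as K[C_1, C_2, ...][N]. *)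
Definition weight_system := forall m, 'S_m -> {poly cpoly K}.

Definition Cvar (k : nat) : {poly cpoly K} := (pvar K k)%:P.

(* The characterization of w_gl by Zhuoke Yang's recursion. Products of
   permutations are applied from left to right: (tau * a) x = a (tau x). *)
Record is_wgl (w : weight_system) : Prop := {
  wgl_empty : forall a : 'S_0, w 0%N a = 1;
  wgl_rot : forall m (a : 'S_m), w m (a ^ long_cycle m)%g = w m a;
  wgl_cat : forall m n (a : 'S_m) (b : 'S_n),
    w (m + n)%N (cat_perm a b) = w m a * w n b;
  wgl_cycle : forall m, w m.+1 (long_cycle m.+1) = Cvar m;
  wgl_swap : forall m (a : 'S_m) (l l' : 'I_m),
    l' = l.+1 :> nat -> a l != l' -> a l' != l ->
    let tau := tperm l l' in
    w m a = w m (tau * a * tau)%g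
            + w _ (restr (tau * a)%g [set~ l']) - w _ (restr (tau * a)%g [set~ l]);
  wgl_swap_adj : forall m (a : 'S_m) (l l' : 'I_m),
    l' = l.+1 :> nat -> a l != l' -> a l' = l ->
    let tau := tperm l l' in
    w m a = w m (tau * a * tau)%g
            + Cvar 0 * w _ (restr a (~: [set l; l'])) - 'X * w _ (restr a [set~ l])
}.

(* C_k := p_k N^(k-1) *)
Definition subst_C (f : {poly cpoly K}) : {poly cpoly K} :=
  (map_poly (peval (fun c => c%:MP%:P) (fun k => pvar K k *: 'X^k)) f).['X].

(* Coefficient of N^e, e in Z, in the Laurent polynomial
   X(a) = N^(c(a) - m) w(a)|_{C_k := p_k N^(k-1)}. *)
Definition prechromatic (w : weight_system) m (a : 'S_m) (e : int) : cpoly K :=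
  match e + m%:Z - #|porbits a|%:Z with
  | Posz n => (subst_C (w m a))`_n
  | Negz _ => 0
  end.

(* X(a) = \sum_k N^(- 2 k) X_k(a) *)
Definition Xcoef (w : weight_system) (k : nat) m (a : 'S_m) : cpoly K :=
  prechromatic w a (- (2 * k)%:Z).

Definition subst_x : cpoly K -> {poly K} := peval polyC (fun _ => 'X).

End WeightSystem.

Section RotationalClasses.

Definition sperm : Type := {m : nat & 'S_m}.
HB.instance Definition _ := Choice.on sperm.

Definition Sperm m (a : 'S_m) : sperm := existT (fun m => 'S_m) m a.
Definition scat (s t : sperm) : sperm := Sperm (cat_perm (tagged s) (tagged t)).

Inductive rot_equiv : sperm -> sperm -> Prop :=
| rot_refl s : rot_equiv s s
| rot_sym s t : rot_equiv s t -> rot_equiv t s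
| rot_trans s t u : rot_equiv s t -> rot_equiv t u -> rot_equiv s u
| rot_conj m (a : 'S_m) : rot_equiv (Sperm a) (Sperm (a ^ long_cycle m)%g)
| rot_cat s s' t t' : rot_equiv s s' -> rot_equiv t t' ->
    rot_equiv (scat s t) (scat s' t').

Definition rot_equivb : rel sperm := fun s t => `[< rot_equiv s t >].

Lemma rot_equivb_equiv : equiv_class_of rot_equivb.
Proof.
split.
- by move=> s; apply/asboolP/rot_refl.
- by move=> s t; apply/idP/idP => /asboolP H; apply/asboolP/rot_sym.
- by move=> t s u /asboolP H1 /asboolP H2; apply/asboolP/(rot_trans H1 H2).
Qed.

Canonical rot_equivb_equivRel : equiv_rel sperm :=
  EquivRelPack rot_equivb_equiv.

Definition rotclass := {eq_quot rot_equivb}%qT.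
HB.instance Definition _ := Choice.on rotclass.

Definition rclass m (a : 'S_m) : rotclass := \pi_rotclass (Sperm a).

Lemma rot_equivP (s t : sperm) :
  \pi_rotclass s = \pi_rotclass t <-> rot_equiv s t.
Proof.
split=> [/eqP|H]; first by rewrite eqmodE => /asboolP.
by apply/eqP; rewrite eqmodE; apply/asboolP.
Qed.

Lemma rot_equiv_repr s : rot_equiv (repr (\pi_rotclass s)) s.
Proof. by apply/rot_equivP; rewrite reprK. Qed.

Lemma spermP (s t : sperm) : tag s = tag t ->
  (forall (i : 'I_(tag s)) (j : 'I_(tag t)), i = j :> nat ->
     tagged s i = tagged t j :> nat) -> s = t.
Proof.
case: s t => [m a] [n b] /= E; subst n => H; congr existT.
by apply/permP => i; apply/ord_inj/H.
Qed.

Lemma cat_permL m n (a : 'S_m) (b : 'S_n) i :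
  cat_perm a b (lshift n i) = lshift n (a i).
Proof. by rewrite permE /cat_fun -[lshift n i]/(unsplit (inl i)) unsplitK. Qed.

Lemma cat_permR m n (a : 'S_m) (b : 'S_n) i :
  cat_perm a b (rshift m i) = rshift m (b i).
Proof. by rewrite permE /cat_fun -[rshift m i]/(unsplit (inr i)) unsplitK. Qed.

Lemma scatA : associative scat.
Proof.
case=> [m a] [n b] [p c]; apply: spermP => /=; first by rewrite addnA.
move=> i j; case: (split_ordP i) => i' ->; case: (split_ordP j) => j' ->.
- case: (split_ordP j') => k -> /= Eij.
    by rewrite !cat_permL /=; move/ord_inj: Eij => ->.
  by have := ltn_ord i'; rewrite Eij /= ltnNge leq_addr.
- by move=> /= Eij; have := ltn_ord i'; rewrite Eij -addnA ltnNge leq_addr.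
- case: (split_ordP i') => k -> /=; case: (split_ordP j') => l -> /= Eij.
  + have := ltn_ord l; by rewrite -Eij ltnNge leq_addr.
  + rewrite cat_permR cat_permL cat_permL cat_permR /=.
    by move/addnI/ord_inj: Eij => ->.
  + have := ltn_ord l; by rewrite -Eij ltnNge leq_addr.
  + by move/addnI: Eij => Eij; have := ltn_ord l; rewrite -Eij ltnNge leq_addr.
- case: (split_ordP i') => k -> /= Eij.
    have := ltn_ord k; rewrite -(ltn_add2l m) Eij -addnA ltn_add2l.
    by rewrite ltnNge leq_addr.
  rewrite !cat_permR /= addnA; congr (_ + _)%N.
  by move: Eij; rewrite addnA => /addnI/ord_inj ->.
Qed.

Definition sempty : sperm := Sperm (1%g : 'S_0).

Lemma scat1s : left_id sempty scat.
Proof.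
case=> [m a]; apply: spermP => //= i j; case: (split_ordP i) => i' -> /= E.
  by case: i' E.
by rewrite cat_permR /=; move/ord_inj: E => ->.
Qed.

Lemma scats1 : right_id sempty scat.
Proof.
case=> [m a]; apply: spermP => /= [|i j]; first by rewrite addn0.
case: (split_ordP i) => i' -> /= E; last by case: i' E.
by rewrite cat_permL /=; move/ord_inj: E => ->.
Qed.

Lemma rot_equiv_conjX m (a : 'S_m) k :
  rot_equiv (Sperm a) (Sperm (a ^ (long_cycle m ^+ k))%g).
Proof.
elim: k => [|k IH]; first by rewrite expg0 conjg1; apply: rot_refl.
by rewrite expgSr conjgM; apply: rot_trans IH (rot_conj _).
Qed.

Lemma long_cycleX m k (i : 'I_m) : (long_cycle m ^+ k)%g i = ((i + k) %% m)%N :> nat.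
Proof.
elim: k => [|k IH]; first by rewrite expg0 perm1 addn0 modn_small.
by rewrite expgSr permM permE /= IH addnS -addn1 modnDml addn1.
Qed.

Lemma scatC s t : rot_equiv (scat s t) (scat t s).
Proof.
case: s t => [m a] [n b]; rewrite /scat /=.
apply: rot_trans (rot_equiv_conjX _ n) _.
set r := (_ ^+ n)%g; have -> : Sperm (cat_perm a b ^ r)%g = Sperm (cat_perm b a).
  have rL i : r (lshift n i) = (n + i)%N :> nat.
    by rewrite long_cycleX /= modn_small addnC // addnC ltn_add2r.
  have rR i : r (rshift m i) = i :> nat.
    by rewrite long_cycleX /= addnAC modnDl modn_small // (leq_trans (ltn_ord i)) ?leq_addl.
  apply: spermP => /= [|i j]; first by rewrite addnC.
  have [k <-] : exists k, r k = i by exists (r^-1 i)%g; rewrite permKV.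
  rewrite permJ; case: (split_ordP k) => l ->.
    rewrite cat_permL !rL => E.
    have -> : j = rshift n l by apply: ord_inj; rewrite -E.
    by rewrite cat_permR.
  rewrite cat_permR !rR => E.
  have -> : j = lshift m l by apply: ord_inj; rewrite -E.
  by rewrite cat_permL.
exact: rot_refl.
Qed.

Definition rone : rotclass := \pi_rotclass sempty.
Definition rmul (c d : rotclass) : rotclass := \pi_rotclass (scat (repr c) (repr d)).

Lemma rmulE s t : rmul (\pi s) (\pi t) = \pi_rotclass (scat s t).
Proof. by apply/rot_equivP/rot_cat; apply: rot_equiv_repr. Qed.

Lemma rot_equiv_tag s t : rot_equiv s t -> tag s = tag t.
Proof.
by elim=> //= [s1 s2 s3 _ -> _ -> | s1 s2 s3 s4 _ -> _ ->].
Qed.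

Lemma rmulA : associative rmul.
Proof.
move=> c d e; rewrite -[c]reprK -[d]reprK -[e]reprK.
by rewrite !rmulE scatA.
Qed.

Lemma rmul1c : left_id rone rmul.
Proof. by move=> c; rewrite -[c]reprK rmulE scat1s. Qed.

Lemma rmulc1 : right_id rone rmul.
Proof. by move=> c; rewrite -[c]reprK rmulE scats1. Qed.

Lemma rmulC : commutative rmul.
Proof.
move=> c d; rewrite -[c]reprK -[d]reprK !rmulE.
exact/rot_equivP/scatC.
Qed.

Lemma rmul_eq1 c d : rmul c d = rone -> c = rone /\ d = rone.
Proof.
have tag0 (s : sperm) : tag s = 0%N -> s = sempty.
  by case: s => [m a] /= E; subst m; apply: spermP => //= -[].
rewrite -[c]reprK -[d]reprK rmulE => /rot_equivP/rot_equiv_tag/eqP.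
by rewrite addn_eq0 => /andP[/eqP/tag0-> /eqP/tag0->].
Qed.

HB.instance Definition _ := Choice_isMonomialDef.Build rotclass
  rmulA rmul1c rmulc1 rmul_eq1.
HB.instance Definition _ := MonomialDef_isConomialDef.Build rotclass rmulC.

Definition rsize (c : rotclass) : nat := tag (repr c).

End RotationalClasses.

(* The algebra A: the monoid algebra of the classes under concatenation. *)
Notation rotalg K := {malg K[rotclass]}.

Section ProductMonoid.
Variables M1 M2 : monomType.

Definition pair_mul (x y : M1 * M2) : M1 * M2 :=
  (mmul x.1 y.1, mmul x.2 y.2).
Definition pair_one : M1 * M2 := (mone, mone).

Lemma pair_mulA : associative pair_mul.
Proof. by move=> x y z; rewrite /pair_mul /= !mulmA. Qed.
Lemma pair_mul1m : left_id pair_one pair_mul.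
Proof. by move=> [x y]; rewrite /pair_mul /= !mul1m. Qed.
Lemma pair_mulm1 : right_id pair_one pair_mul.
Proof. by move=> [x y]; rewrite /pair_mul /= !mulm1. Qed.
Lemma pair_unitm x y : pair_mul x y = pair_one -> x = pair_one /\ y = pair_one.
Proof.
case: x y => [x1 x2] [y1 y2] [/unitm[/= -> ->] /unitm[/= -> ->]]; by [].
Qed.

HB.instance Definition _ := Choice_isMonomialDef.Build (M1 * M2)%type
  pair_mulA pair_mul1m pair_mulm1 pair_unitm.

End ProductMonoid.

Section ProductCommutativeMonoid.
Variables M1 M2 : conomType.

Lemma pair_mulC : commutative (@pair_mul M1 M2).
Proof.
by move=> x y; rewrite /pair_mul [mmul x.1 _]mulmC [mmul x.2 _]mulmC.
Qed.

HB.instance Definition _ :=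
  MonomialDef_isConomialDef.Build (M1 * M2)%type pair_mulC.

End ProductCommutativeMonoid.

Section HopfStructure.
Variable K : fieldType.

Definition lin_ext (M : choiceType) (V : lmodType K) (f : M -> V)
    (a : {malg K[M]}) : V :=
  \sum_(c <- msupp a) a@_c *: f c.

(* The tensor product {malg K[M1]} (x) {malg K[M2]} is {malg K[M1 * M2]}. *)
Definition tens (M1 M2 : choiceType) (a : {malg K[M1]}) (b : {malg K[M2]}) :
    {malg K[(M1 * M2)%type]} :=
  \sum_(x <- msupp a) \sum_(y <- msupp b) << a@_x * b@_y *g (x, y) >>.

Definition tens_map (M1 M2 L1 L2 : choiceType)
    (f : {malg K[M1]} -> {malg K[L1]}) (g : {malg K[M2]} -> {malg K[L2]}) :
    {malg K[(M1 * M2)%type]} -> {malg K[(L1 * L2)%type]} :=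
  lin_ext (fun z : (M1 * M2)%type => tens (f << z.1 >>) (g << z.2 >>)).

Definition counit (M : monomType) (a : {malg K[M]}) : K := a@_mone.

Definition cpoly_comul : cpoly K -> {malg K[({cmonom nat} * {cmonom nat})%type]} :=
  peval (fun c => c%:MP) (fun k => tens 1 (pvar K k) + tens (pvar K k) 1).

Definition perm_comul m (a : 'S_m) : {malg K[(rotclass * rotclass)%type]} :=
  \sum_(I in powerset (porbits a))
    << (rclass (restr a (cover I)), rclass (restr a (cover (porbits a :\: I)))) >>.

Definition rotalg_comul : rotalg K -> {malg K[(rotclass * rotclass)%type]} :=
  lin_ext (fun c : rotclass => perm_comul (tagged (repr c))).

Definition rotalg_filt (n : nat) (a : rotalg K) : Prop :=
  forall c, c \in msupp a -> (rsize c <= n)%N.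

(* The span of the classes of the permutations satisfying P. *)
Definition span_of (P : forall m, 'S_m -> bool) (a : rotalg K) : Prop :=
  forall c, c \in msupp a -> exists m (b : 'S_m), P m b /\ c = rclass b.

Definition rotalg_pos : rotalg K -> Prop := span_of positive.
Definition rotalg_chord : rotalg K -> Prop := span_of chord_diagram.

Definition X0_map (w : weight_system K) : rotalg K -> cpoly K :=
  lin_ext (fun c : rotclass => Xcoef w 0 (tagged (repr c))).

(* The restriction of f to the subspace H is a homomorphism of bialgebras
   (hence it also commutes with the antipodes) compatible with the
   filtrations. *)
Record filtered_hopf_hom_on (H : rotalg K -> Prop) (f : rotalg K -> cpoly K) :
    Prop := {
  hopf_hom_linear : forall (k : K) a b, H a -> H b ->
    f (k *: a + b) = k *: f a + f b;
  hopf_hom_one : f 1 = 1;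
  hopf_hom_mul : forall a b, H a -> H b -> f (a * b) = f a * f b;
  hopf_hom_counit : forall a, H a -> counit (f a) = counit a;
  hopf_hom_comul : forall a, H a ->
    tens_map f f (rotalg_comul a) = cpoly_comul (f a);
  hopf_hom_filtered : forall n a, H a -> rotalg_filt n a -> cpoly_filt n (f a)
}.

End HopfStructure.

(* X0_map does not depend on the representatives chosen by repr. *)
Section WellDefined.

Lemma porbit_conj m (a s : 'S_m) x : porbit (a ^ s)%g (s x) = s @: porbit a x.
Proof.
apply/setP => y; apply/porbitP/imsetP => [[k ->]|[z /porbitP[k ->] ->]].
  by exists ((a ^+ k)%g x); [apply: mem_porbit | rewrite -conjXg permJ].
by exists k; rewrite -conjXg permJ.
Qed.

Lemma card_porbits_conj m (a s : 'S_m) : #|porbits (a ^ s)%g| = #|porbits a|.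
Proof.
have -> : porbits (a ^ s)%g = (fun A : {set 'I_m} => s @: A) @: porbits a.
  apply/setP => A; apply/imsetP/imsetP => [[x _ ->]|[B /imsetP[x _ ->] ->]].
    exists (porbit a (s^-1 x)%g); first exact: imset_f.
    by rewrite -porbit_conj permKV.
  by exists (s x); rewrite ?porbit_conj.
by rewrite card_imset //; apply: imset_inj; apply: perm_inj.
Qed.

Lemma porbit_catL m n (a : 'S_m) (b : 'S_n) i :
  porbit (cat_perm a b) (lshift n i) = lshift n @: porbit a i.
Proof.
have H k : (cat_perm a b ^+ k)%g (lshift n i) = lshift n ((a ^+ k)%g i).
  by elim: k => [|k IH]; rewrite ?expg0 ?perm1 // !expgSr !permM IH cat_permL.
apply/setP => y; apply/porbitP/imsetP => [[k ->]|[z /porbitP[k ->] ->]].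
  by exists ((a ^+ k)%g i); [apply: mem_porbit | rewrite H].
by exists k; rewrite H.
Qed.

Lemma porbit_catR m n (a : 'S_m) (b : 'S_n) i :
  porbit (cat_perm a b) (rshift m i) = @rshift m n @: porbit b i.
Proof.
have H k : (cat_perm a b ^+ k)%g (rshift m i) = rshift m ((b ^+ k)%g i).
  by elim: k => [|k IH]; rewrite ?expg0 ?perm1 // !expgSr !permM IH cat_permR.
apply/setP => y; apply/porbitP/imsetP => [[k ->]|[z /porbitP[k ->] ->]].
  by exists ((b ^+ k)%g i); [apply: mem_porbit | rewrite H].
by exists k; rewrite H.
Qed.

Lemma card_porbits_cat m n (a : 'S_m) (b : 'S_n) :
  #|porbits (cat_perm a b)| = (#|porbits a| + #|porbits b|)%N.
Proof.
set fL := fun A : {set 'I_m} => lshift n @: A.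
set fR := fun A : {set 'I_n} => @rshift m n @: A.
have -> : porbits (cat_perm a b) = (fL @: porbits a) :|: (fR @: porbits b).
  apply/setP => A; rewrite inE; apply/imsetP/orP.
    move=> [x _ ->]; case: (split_ordP x) => i ->.
      by left; rewrite porbit_catL; do 2 apply: imset_f.
    by right; rewrite porbit_catR; do 2 apply: imset_f.
  case=> /imsetP[B /imsetP[x _ ->] ->].
    by exists (lshift n x); rewrite ?porbit_catL.
  by exists (rshift m x); rewrite ?porbit_catR.
rewrite cardsU (_ : _ :&: _ = finset.set0) ?cards0 ?subn0.
  by rewrite (card_imset _ (imset_inj (@lshift_inj m n)))
             (card_imset _ (imset_inj (@rshift_inj m n))).
apply/setP => A; rewrite !inE; apply/andP => -[/imsetP[B /imsetP[x _ ->] ->]].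
case/imsetP => C /imsetP[y _ ->] /setP/(_ (lshift n x)).
rewrite imset_f ?porbit_id // => /esym/imsetP[z _ /eqP].
by rewrite eq_lrshift.
Qed.

Variable K : fieldType.
Variable w : weight_system K.
Hypothesis w_gl : is_wgl w.

Lemma rot_equiv_inv s t : rot_equiv s t ->
  [/\ tag s = tag t, #|porbits (tagged s)| = #|porbits (tagged t)|
    & w (tagged s) = w (tagged t)].
Proof.
elim=> {s t} [s|s t _ []|s t u _ [e1 c1 w1] _ [e2 c2 w2]|m a|
              s s' t t' _ [e1 c1 w1] _ [e2 c2 w2]] //=.
  by split; [exact: etrans e1 e2 | exact: etrans c1 c2 | exact: etrans w1 w2].
  by rewrite card_porbits_conj (wgl_rot w_gl).
by split; rewrite ?e1 ?e2 // ?card_porbits_cat ?c1 ?c2 // !(wgl_cat w_gl) w1 w2.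
Qed.

Lemma X0_mapE m (a : 'S_m) : X0_map w << rclass a >> = Xcoef w 0 a.
Proof.
rewrite /X0_map /lin_ext msuppU1 big_seq_fset1 mcoeffUU scale1r.
have [/= t c e] := rot_equiv_inv (rot_equiv_repr (Sperm a)).
by rewrite /Xcoef /prechromatic c e t.
Qed.

End WellDefined.

(* Main.v *)
(* Under C_k := p_k N^(k-1), Yang's recursion shows that w_gl(a) has degree at
   most m - c(a) in N, and X_0(a) is the coefficient of N^(m - c(a)). Comparing
   these coefficients, X_0 satisfies, for the swap a' of l and l+1 in a:
     X_0(a) = X_0(a') + X_0(b_1) - X_0(b_2)  if l, l+1 are in distinct cycles,
     X_0(a) = X_0(a')                        if they are in the same cycle,
                                             a(l) != l+1 and a(l+1) != l,
     X_0(a) = X_0(a') - X_0(a minus l)       if a(l+1) = l, a(l) != l+1.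
   Swaps lead from any permutation to a concatenation of standard cycles, so
   these rules ([swap_rec]), together with multiplicativity, determine X_0.

   The rules are stable under convolution ([conv]): if each phi_k satisfies
   them, so does the sum over all colorings f of the cycles of a of the product
   over the colors k of phi_k(a restricted to the color k). With two colors and
   phi = X_0 (x) 1, 1 (x) X_0 this gives the compatibility of X_0 with the
   comultiplications, on the whole of A.

   At p_1 = p_2 = ... = 1 the rules are satisfied by the indicator of the
   planar permutations (those of genus 0, i.e. whose numbers of cycles and of
   faces add up to m + 1). Hence X_0(a) at p_1 = p_2 = ... = n is the number of
   colorings of the cycles of a by n colors such that the restriction to each
   color is planar; for a positive, planar means without interlacing cycles, so
   these are the proper colorings of the intersection graph. *)
Require Import Defs.
From HB Require Import structures.
From mathcomp Require Import all_boot all_order all_algebra all_fingroup.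
From mathcomp Require Import generic_quotient boolp reals complex.
From mathcomp Require Import finmap monalg zify ring.
Set Implicit Arguments.
Unset Strict Implicit.
Unset Printing Implicit Defensive.
Import GRing.Theory.
Local Open Scope ring_scope.

(** * Restrictions and order-preserving relabelling *)

Definition increasing m n (i : 'I_n -> 'I_m) : Prop :=
  forall x y : 'I_n, (x < y)%N -> (i x < i y)%N.

Lemma increasing_inj m n (i : 'I_n -> 'I_m) : increasing i -> injective i.
Proof.
move=> inc x y e; apply/ord_inj; case: (ltngtP x y) => // /inc; by rewrite e ltnn.
Qed.

Lemma increasing_comp m n p (i : 'I_n -> 'I_m) (j : 'I_p -> 'I_n) :
  increasing i -> increasing j -> increasing (fun x => i (j x)).
Proof. by move=> hi hj x y /hj/hi. Qed.

Lemma enum_val_increasing m (U : {set 'I_m}) :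
  increasing (@enum_val _ (mem U)).
Proof.
move=> x y lt_xy.
have s_enum : sorted ltn (map val (enum U)).
  rewrite /enum_mem (eq_filter (a2 := fun z => val z \in map val (enum U))).
    rewrite -enumT -filter_map val_enum_ord; apply: sorted_filter.
      by move=> ? ? ?; apply: ltn_trans.
    exact: iota_ltn_sorted.
  by move=> z /=; rewrite (mem_map val_inj) mem_enum.
have lt_y : (y < size (enum U))%N by rewrite -cardE.
have lt_x : (x < size (enum U))%N by apply: ltn_trans lt_y.
have x0 := enum_val x.
rewrite !(enum_val_nth x0) -!(nth_map x0 0%N val) //.
by apply: (sorted_ltn_nth ltn_trans) => //; rewrite inE size_map.
Qed.

Lemma enum_val_lt m (U : {set 'I_m}) (i j : 'I_#|U|) :
  (enum_val i < enum_val j)%N = (i < j)%N.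
Proof.
have inc := @enum_val_increasing _ U.
case: (ltngtP i j) => [/inc->//|/inc h|/ord_inj->]; last by rewrite ltnn.
by apply/negbTE; rewrite -leqNgt ltnW.
Qed.

(** A subset of ['I_m] has only one increasing enumeration, so equal images force [n = n'] and
    [i = i']. The conclusion lives in [sperm] because the two sizes are in general not convertible;
    identifications of restrictions below go through it, with [F] either a permutation or
    [del a p]. *)
Lemma sperm_eq_of_copies m n n' (b : 'S_n) (b' : 'S_n')
    (i : 'I_n -> 'I_m) (i' : 'I_n' -> 'I_m) (F : 'I_m -> 'I_m) :
  increasing i -> increasing i' -> codom i =i codom i' ->
  (forall x, i (b x) = F (i x)) -> (forall x, i' (b' x) = F (i' x)) ->
  Sperm b = Sperm b'.
Proof.
move=> hi hi' him hb hb'.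
have S k (j : 'I_k -> 'I_m) : increasing j -> sorted ltn (map (val \o j) (enum 'I_k)).
  move=> hj; rewrite sorted_map.
  have : sorted ltn (map val (enum 'I_k)) by rewrite val_enum_ord iota_ltn_sorted.
  by rewrite sorted_map; apply: sub_sorted => x y; apply: hj.
have E : map (val \o i) (enum 'I_n) = map (val \o i') (enum 'I_n').
  apply: (irr_sorted_eq ltn_trans ltnn) => [||z]; [exact: S | exact: S |].
  have C k (j : 'I_k -> 'I_m) : map (val \o j) (enum 'I_k) = map val (codom j).
    by rewrite map_comp.
  by rewrite !C; apply/mapP/mapP => -[y hy ->]; exists y; rewrite // ?him // -him.
have en : n = n'.
  by have := congr1 size E; rewrite !size_map -!enumT -!cardT !card_ord.
subst n'.
have ei x : i x = i' x.
  by have/eq_in_map/(_ x) := E; rewrite mem_enum => /(_ isT)/val_inj.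
congr (Sperm _); apply/permP => x; apply: (increasing_inj hi).
by rewrite hb ei -hb' ei.
Qed.

Lemma codom_enum_val m (U : {set 'I_m}) : codom (@enum_val _ (mem U)) =i U.
Proof.
move=> x; apply/codomP/idP => [[y ->]|xU]; first exact: enum_valP.
by exists (enum_rank_in xU x); rewrite enum_rankK_in.
Qed.

Lemma enum_val_ex m (U : {set 'I_m}) x : x \in U ->
  exists y : 'I_#|U|, enum_val y = x.
Proof. by move=> xU; exists (enum_rank_in xU x); rewrite enum_rankK_in. Qed.

Lemma enum_val_restr m (a : 'S_m) (U : {set 'I_m}) (i : 'I_#|U|) :
  enum_val (restr a U i) = first_return a U (enum_val i).
Proof.
rewrite permE /restr_fun enum_rankK_in //.
by have [] := return_timeP a (enum_valP i).
Qed.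

Lemma first_return_uniq m (a : 'S_m) (U : {set 'I_m}) x k :
  x \in U -> iter k.+1 a x \in U ->
  (forall j, (j < k)%N -> iter j.+1 a x \notin U) ->
  first_return a U x = iter k.+1 a x.
Proof.
move=> xU kU notU; have [rU rN] := return_timeP a xU.
rewrite /first_return in rU *; congr (iter _.+1 a x).
case: (ltngtP (return_time a U x) k) => // [/notU|/rN]; last by rewrite kU.
by rewrite rU.
Qed.

(** The permutation [a] short-circuited past [p], kept as a self-map of ['I_m] so that deletions can
    be compared before any renumbering. Only its values off [p] matter. *)
Definition del m (a : 'S_m) (p x : 'I_m) : 'I_m := if a x == p then a p else a x.

Lemma first_return1 m (a : 'S_m) (U : {set 'I_m}) x :
  x \in U -> a x \in U -> first_return a U x = a x.
Proof. by move=> xU axU; rewrite (@first_return_uniq _ a U x 0). Qed.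

Lemma first_return_del m (a : 'S_m) (U : {set 'I_m}) p x :
  (forall y, (a y \in U) = (y \in U)) -> x \in U :\ p ->
  first_return a (U :\ p) x = del a p x.
Proof.
move=> aU xU; have := xU; rewrite 2!inE => /andP[xp xinU]; rewrite /del.
case: eqP => [axp|/eqP axp]; last by rewrite first_return1 // !inE axp aU.
rewrite (@first_return_uniq _ a _ x 1) //= ?axp //.
  rewrite !inE aU -axp aU xinU andbT.
  by apply: contra xp => /eqP/perm_inj <-; rewrite axp.
by case=> [_|//]; rewrite /= axp !inE eqxx.
Qed.

Lemma enum_val_restr_del m (a : 'S_m) (U : {set 'I_m}) p i :
  (forall y, (a y \in U) = (y \in U)) ->
  enum_val (restr a (U :\ p) i) = del a p (enum_val i).
Proof.
by move=> aU; rewrite enum_val_restr first_return_del //; apply: enum_valP.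
Qed.

Lemma enum_val_restr1 m (a : 'S_m) p (i : 'I_#|[set~ p]|) :
  enum_val (restr a [set~ p] i) = del a p (enum_val i).
Proof.
rewrite enum_val_restr; have e : [set~ p] = finset.setT :\ p.
  by apply/setP => x; rewrite !inE andbT.
have {1}-> : first_return a [set~ p] = first_return a (finset.setT :\ p) by rewrite -e.
rewrite first_return_del //; first by move=> y; rewrite !inE.
by rewrite -e enum_valP.
Qed.

Lemma enum_val_restr_inv m (a : 'S_m) (U : {set 'I_m}) i :
  (forall y, (a y \in U) = (y \in U)) ->
  enum_val (restr a U i) = a (enum_val i).
Proof.
by move=> aU; rewrite enum_val_restr first_return1 ?aU // enum_valP.
Qed.

Lemma card_imset_same_kernel (T : finType) (U V : finType) (f : T -> U) (g : T -> V) :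
  (forall x y, (f x == f y) = (g x == g y)) -> #|f @: T| = #|g @: T|.
Proof.
(* [h] carries the value [f x] to the singleton of [g x]; equality of the kernels makes this well
   defined and injective on the image of [f]. *)
move=> E; pose h A := [set g x | x in [set x | f x == A]].
have hE x : h (f x) = [set g x].
  apply/setP => z; rewrite inE; apply/imsetP/eqP => [[y]|->].
    by rewrite inE E => /eqP-> ->.
  by exists x; rewrite ?inE.
rewrite -(card_in_imset (f := h)).
  rewrite -(card_imset _ (@set1_inj V)); apply: eq_card => A.
  apply/imsetP/imsetP => -[B /imsetP[x _ ->] ->].
    by exists (g x); rewrite ?imset_f.
  by exists (f x); rewrite ?imset_f.
move=> A B /imsetP[x _ ->] /imsetP[y _ ->]; rewrite !hE => /set1_inj/eqP.
by rewrite -E => /eqP.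
Qed.

Lemma porbit_trans (T : finType) (a : {perm T}) x y z :
  y \in porbit a x -> z \in porbit a y -> z \in porbit a x.
Proof. by rewrite -eq_porbit_mem => /eqP->. Qed.

(** * Cycles of a restriction and cycle counts *)

Section RestrOrbits.
Variables (m : nat) (a : 'S_m) (U : {set 'I_m}).

Lemma porbit_restr i j :
  (j \in porbit (restr a U) i) = (enum_val j \in porbit a (enum_val i)).
Proof.
apply/idP/idP => /porbitP[k].
  elim: k j => [|k IH] j; first by rewrite expg0 perm1 => ->; apply: porbit_id.
  rewrite expgSr permM => ->; rewrite enum_val_restr /first_return.
  have := IH _ erefl; set x := enum_val _ => hx.
  by apply: (porbit_trans hx) ; rewrite -permX mem_porbit.
elim/ltn_ind: k i => k IH i; case: k IH => [|k] IH.
  by rewrite expg0 perm1 => /enum_val_inj->; apply: porbit_id.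
move=> E; set r := return_time a U (enum_val i).
have [rU rN] := return_timeP a (enum_valP i).
(* The first return takes [r + 1] steps. If [r <= k], the remaining [k - r] steps start at a point
   of [U] and induction applies; otherwise the walk of [k + 1] steps would end outside [U]. *)
case: (leqP r k) => hr.
  apply: (@porbit_trans _ _ _ (restr a U i)).
    by have := mem_porbit (restr a U) 1 i; rewrite expg1.
  apply: (IH (k - r)%N); first by rewrite ltnS leq_subr.
  rewrite enum_val_restr /first_return -/r -permX -permM -expgD E.
  by congr ((a ^+ _)%g _); lia.
by have := rN _ hr; rewrite -permX -E enum_valP.
Qed.

Lemma card_porbits_restr :
  #|porbits (restr a U)| = #|[set A in porbits a | A :&: U != finset.set0]|.
Proof.
rewrite (@card_imset_same_kernel _ _ _ _ (fun i => porbit a (enum_val i))).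
  apply: eq_card => A; rewrite inE; apply/imsetP/andP.
    move=> [i _ ->]; rewrite imset_f //; split=> //; apply/set0Pn.
    by exists (enum_val i); rewrite inE porbit_id enum_valP.
  case=> /imsetP[x _ ->] /set0Pn[y]; rewrite inE => /andP[yx yU].
  have [i ei] := enum_val_ex yU; exists i => //; rewrite ei.
  by apply/eqP; rewrite eq_porbit_mem porbit_sym.
by move=> i j; rewrite !eq_porbit_mem porbit_restr.
Qed.

End RestrOrbits.

Definition ncycles m (a : 'S_m) : nat := #|porbits a|.

Lemma ncycles_del m (a : 'S_m) p : a p != p ->
  ncycles (restr a [set~ p]) = ncycles a.
Proof.
move=> ap; rewrite /ncycles card_porbits_restr; apply: eq_card => A; rewrite inE.
apply/andb_idr => /imsetP[x _ ->]; apply/set0Pn.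
have [px|px] := boolP (p \in porbit a x).
  exists (a p); rewrite !inE ap andbT.
  by apply: (porbit_trans px); have := mem_porbit a 1 p; rewrite expg1.
by exists x; rewrite !inE porbit_id; apply: contraNneq px => ->; apply: porbit_id.
Qed.

Lemma ncycles_del_fixed m (a : 'S_m) p : a p = p ->
  ncycles a = (ncycles (restr a [set~ p])).+1.
Proof.
move=> ap; have px : porbit a p = [set p].
  apply/setP => y; rewrite inE; apply/porbitP/eqP => [[k ->]|->].
    by elim: k => [|k IH]; rewrite ?expg0 ?perm1 // expgSr permM IH.
  by exists 0%N; rewrite expg0 perm1.
rewrite /ncycles card_porbits_restr (cardsD1 [set p]) -{1}px imset_f // add1n; congr _.+1.
apply: eq_card => A; rewrite !inE andbC; apply: andb_id2l => /imsetP[x _ ->].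
apply/idP/set0Pn => [xp|[y]].
  exists x; rewrite !inE porbit_id; apply: contra xp => /eqP->.
  by rewrite px.
rewrite !inE => /andP[yx yp]; apply: contra yp => /eqP e; move: yx.
by rewrite e inE.
Qed.

Lemma leq_ncycles m (a : 'S_m) : (ncycles a <= m)%N.
Proof. by apply: leq_trans (leq_imset_card _ _) _; rewrite card_ord. Qed.

(** A transposition merges two cycles or splits one; putting the doubled indicator on the left
    avoids truncated subtraction. *)
Lemma ncycles_tperm m (a : 'S_m) l l' : l != l' ->
  (ncycles (tperm l l' * a)%g + (l' \notin porbit a l).*2 = (ncycles a).+1)%N.
Proof.
move=> ll'; rewrite /ncycles; have := porbits_mul_tperm a l' l; rewrite /= tpermC => ->.
by rewrite eq_sym ll' addn1.
Qed.

Lemma ncycles_tpermJ m (a : 'S_m) l l' :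
  ncycles (tperm l l' * a * tperm l l')%g = ncycles a.
Proof. by rewrite /ncycles -(card_porbits_conj a (tperm l l')) conjgE tpermV mulgA. Qed.

Lemma ncycles_cat m n (a : 'S_m) (b : 'S_n) :
  ncycles (cat_perm a b) = (ncycles a + ncycles b)%N.
Proof. exact: card_porbits_cat. Qed.

(** * Reduction of permutations by adjacent swaps *)

Definition conj_inv m (P : 'S_m -> Prop) (s : 'S_m) := forall a, P a -> P (a ^ s)%g.

(** Adjacent transpositions generate the symmetric group, and the permutations preserving [P] by
    conjugation are closed under products. *)
Lemma conj_inv_adjacent m (P : 'S_m -> Prop) :
  (forall l l' : 'I_m, l' = l.+1 :> nat -> conj_inv P (tperm l l')) ->
  forall s, conj_inv P s.
Proof.
move=> H; have M s t : conj_inv P s -> conj_inv P t -> conj_inv P (s * t)%g.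
  by move=> hs ht a /hs/ht; rewrite conjgM.
have T (i j : 'I_m) : (i < j)%N -> conj_inv P (tperm i j).
  move: {2}(j - i)%N (leqnn (j - i)) => d; elim: d i j => [|d IH] i j hd lt_ij.
    by lia.
  have [/H//|jS] := eqVneq (j : nat) i.+1.
  have lt_k : (j.-1 < m)%N by have := ltn_ord j; lia.
  pose k := Ordinal lt_k.
  (* With [k = j - 1], the transposition of [i] and [j] is a conjugate of the shorter one of [i] and
     [k] by an adjacent one. *)
  have -> : tperm i j = (tperm k j * (tperm i k * tperm k j))%g.
    rewrite -{1}[tperm k j]tpermV -conjgE tpermJ tpermL tpermD //; apply/eqP.
      by move=> /(congr1 val) /=; lia.
    by move=> /(congr1 val) /=; lia.
  have Hkj : conj_inv P (tperm k j) by apply: H => /=; lia.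
  by apply: (M) => //; apply: M => //; apply: IH => /=; lia.
move=> s; case: (prod_tpermP s) => ts -> _; elim: ts => [|t ts IH].
  by rewrite big_nil => a; rewrite conjg1.
rewrite big_cons; apply: M => //; case: t => i j /=.
case: (ltngtP i j) => [/T//|/T|/ord_inj->]; first by rewrite tpermC.
by rewrite tperm1 => a; rewrite conjg1.
Qed.

Lemma cat_perm_of_block k n (c : 'S_(k + n)) (d : 'S_k) :
  (forall i, c (lshift n i) = lshift n (d i)) -> exists b : 'S_n, c = cat_perm d b.
Proof.
move=> H; have R j : exists j', c (rshift k j) == rshift k j'.
  case: (split_ordP (c (rshift k j))) => i Ei; last by exists i; rewrite Ei.
  have := H (d^-1 i)%g; rewrite permKV -Ei => /perm_inj/eqP.
  by rewrite eq_lrshift.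
pose b j := xchoose (R j).
have bE j : c (rshift k j) = rshift k (b j) by apply/eqP/(xchooseP (R j)).
have binj : injective b.
  by move=> i j e; apply/(@rshift_inj k)/(@perm_inj _ c); rewrite !bE e.
exists (perm binj); apply/permP => i.
by case: (split_ordP i) => j ->; rewrite ?cat_permL ?cat_permR ?H ?bE ?permE.
Qed.

(** The conjugator renumbers the cycle of [x0] by 0, ..., k in the order in which [a] runs through
    it; what remains is a permutation of the last block. *)
Lemma conj_cat_cycle m (a : 'S_m) (x0 : 'I_m) :
  exists k n (b : 'S_n) s, Sperm (a ^ s)%g = Sperm (cat_perm (long_cycle k.+1) b).
Proof.
have [k Ek] : exists k, #|porbit a x0| = k.+1.
  by exists (#|porbit a x0|.-1); rewrite prednK // lt0n card_porbit_neq0.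
have [n en] : exists n, m = (k.+1 + n)%N.
  exists (m - k.+1)%N; rewrite subnKC // -Ek.
  by apply: leq_trans (max_card _) _; rewrite card_ord.
subst m; pose x i := iter i a x0.
have x_inj i j : (i <= k)%N -> (j <= k)%N -> x i = x j -> i = j.
  move=> hi hj e; have U := uniq_traject_porbit a x0.
  have := nth_uniq x0 _ _ U; rewrite !size_traject Ek => /(_ i j).
  by rewrite !ltnS !nth_traject // -/(x i) -/(x j) e eqxx => /(_ hi hj)/esym/eqP.
(* The values of [s] on [x 0], [x 1], ... are prescribed one at a time: the transposition correcting
   the value at [x j] moves none of the earlier values. *)
have [s Hs] : exists s : 'S_(k.+1 + n), forall i, (i < k.+1)%N -> s (x i) = i :> nat.
  suff H j : (j <= k.+1)%N -> exists s : 'S_(k.+1 + n),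
      forall i, (i < j)%N -> s (x i) = i :> nat by exact: H.
  elim: j => [|j IH] le_j; first by exists 1%g.
  have [s Hs] := IH (ltnW le_j).
  have lt_j : (j < k.+1 + n)%N by lia.
  exists (s * tperm (s (x j)) (Ordinal lt_j))%g => i; rewrite ltnS leq_eqVlt.
  case/orP => [/eqP->|lt_i]; first by rewrite permM tpermL.
  rewrite permM tpermD ?Hs //.
    by apply/eqP => /perm_inj/x_inj e; have := ltnn i; rewrite -{2}e ?lt_i //; lia.
  by apply/eqP => /(congr1 val) /=; rewrite Hs // => e; lia.
have [b Eb] : exists b, (a ^ s)%g = cat_perm (long_cycle k.+1) b.
  apply: cat_perm_of_block => i.
  have -> : lshift n i = s (x i) by apply: ord_inj; rewrite Hs.
  rewrite permJ permE; apply: ord_inj => /=.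
  have [->|ik] := eqVneq (i : nat) k.
    have -> : a (x k) = x 0%N by have := iter_porbit a x0; rewrite Ek.
    by rewrite modnn Hs.
  by rewrite (Hs i.+1) ?modn_small //; have := ltn_ord i; lia.
by exists k, n, b, s; rewrite Eb.
Qed.

(** Strong induction on [m]: [a] is conjugate to a standard cycle concatenated with a smaller
    permutation, and the conjugation is a chain of adjacent swaps along which [P] is carried back to
    [a]. *)
Lemma swap_ind (P : forall m, 'S_m -> Prop) :
  (forall a : 'S_0, P 0%N a) ->
  (forall k n (b : 'S_n), P n b -> P _ (cat_perm (long_cycle k.+1) b)) ->
  (forall m (a : 'S_m) (l l' : 'I_m), l' = l.+1 :> nat -> a l != l' ->
     (forall n (b : 'S_n), (n < m)%N -> P n b) ->
     P m a <-> P m (tperm l l' * a * tperm l l')%g) ->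
  forall m (a : 'S_m), P m a.
Proof.
move=> P0 Pcat Pswap m; have [n le_mn] := ubnP m; elim: n m le_mn => // n IH m.
rewrite ltnS => le_mn a; case: m => [|m] in le_mn a *; first exact: P0.
have {}IH k (b : 'S_k) : (k < m.+1)%N -> P k b.
  by move=> lt_k; apply: IH; apply: leq_trans le_mn.
have [k [p [b [s Es]]]] := conj_cat_cycle a ord0.
have inv : conj_inv (P m.+1) s^-1%g.
  apply: conj_inv_adjacent => l l' el c Pc.
  have ll' : l != l' by apply/eqP => /(congr1 val) /=; lia.
  rewrite conjgE tpermV mulgA.
  (* The swap hypothesis does not cover [c l = l']. There it is applied backwards to the swapped
     permutation, unless also [c l' = l], when the swap leaves [c] unchanged. *)
  have [e1|n1] := eqVneq (c l) l'; last exact/(Pswap _ _ _ _ el n1 IH).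
  have [e2|n2] := eqVneq (c l') l.
    have -> // : (tperm l l' * c * tperm l l')%g = c.
    apply/permP => x; rewrite !permM; case: (tpermP l l' x) => [->|->|x1 x2].
    - by rewrite e2 tpermL.
    - by rewrite e1 tpermR.
    - rewrite tpermD //; apply/eqP => e.
        by apply: x2; apply: (@perm_inj _ c); rewrite e2.
      by apply: x1; apply: (@perm_inj _ c); rewrite e1.
  have n2' : (tperm l l' * c * tperm l l')%g l != l'.
    rewrite !permM tpermL; apply: contra n2 => /eqP e.
    by rewrite -(tpermK l l' (c l')) e tpermR.
  apply/(Pswap _ _ _ _ el n2' IH).
  by rewrite !mulgA tperm2 mul1g -mulgA tperm2 mulg1.
rewrite -[a](conjgK s); apply: inv.
have : P (tag (Sperm (cat_perm (long_cycle k.+1) b)))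
         (tagged (Sperm (cat_perm (long_cycle k.+1) b))).
  apply: Pcat; apply: IH.
  by have := congr1 tag Es => /= ->; rewrite -[p.+1]add1n leq_add2r.
by rewrite -Es.
Qed.

(** * Leading coefficients in N *)

Section Evaluation.
Variables (K : fieldType) (S : comNzRingType) (v : nat -> S).

Lemma cmonom_evalEw (d : {fset nat}) (mon : {cmonom nat}) :
  (finsupp mon `<=` d)%fset -> cmonom_eval v mon = \prod_(i <- d) v i ^+ mon i.
Proof.
move=> le; rewrite /cmonom_eval (big_fset_incl _ le) //.
by move=> i _; rewrite -cmE_neq0 negbK => /eqP->; rewrite expr0.
Qed.

Lemma cmonom_eval_mmorphism : mmorphism (cmonom_eval v).
Proof.
split=> [x y|]; last by rewrite /cmonom_eval mdom1 big_seq_fset0.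
rewrite (@cmonom_evalEw _ x (fsubsetUl _ (finsupp y))).
rewrite (@cmonom_evalEw _ y (fsubsetUr (finsupp x) _)).
rewrite /cmonom_eval mdomD -big_split /=; apply: eq_bigr => i _.
by rewrite cmM exprD.
Qed.

HB.instance Definition _ :=
  isMultiplicative.Build {cmonom nat} S (cmonom_eval v) cmonom_eval_mmorphism.

Variable f : {rmorphism K -> S}.

Lemma peval_additive : additive (peval f v).
Proof. exact: mmap_is_additive. Qed.

Lemma peval_multiplicative : multiplicative (peval f v).
Proof. exact: mmap_is_multiplicative. Qed.

HB.instance Definition _ :=
  GRing.isAdditive.Build (cpoly K) S (peval f v) peval_additive.
HB.instance Definition _ :=
  GRing.isMultiplicative.Build (cpoly K) S (peval f v) peval_multiplicative.

Lemma peval_pvar k : peval f v (pvar K k) = v k.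
Proof.
by rewrite /peval mmapU /= rmorph1 mul1r /cmonom_eval mdomU big_seq_fset1 cmUU.
Qed.

Lemma pevalC c : peval f v c%:MP = f c.
Proof. exact: mmapC. Qed.

End Evaluation.

Section SubstC.
Variable K : fieldType.

Definition subst_C_coef : cpoly K -> {poly cpoly K} :=
  peval (polyC \o malgC) (fun k => pvar K k *: 'X^k).

HB.instance Definition _ := GRing.RMorphism.on subst_C_coef.

(** The substitution fixes N: it acts on the coefficients and is followed by evaluation of the outer
    variable at N. As a composite of ring morphisms it is one itself. *)
Lemma subst_CE f : subst_C f = horner_eval 'X (map_poly subst_C_coef f).
Proof. by []. Qed.

Lemma subst_C_additive : additive (@subst_C K).
Proof. by move=> f g; rewrite !subst_CE !rmorphB. Qed.

Lemma subst_C_multiplicative : multiplicative (@subst_C K).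
Proof. by split=> [f g|]; rewrite !subst_CE ?rmorphM ?rmorph1. Qed.

Lemma subst_CB (f g : {poly cpoly K}) : subst_C (f - g) = subst_C f - subst_C g.
Proof. exact: subst_C_additive. Qed.

Lemma subst_CD (f g : {poly cpoly K}) : subst_C (f + g) = subst_C f + subst_C g.
Proof. by rewrite !subst_CE !rmorphD. Qed.

Lemma subst_CM (f g : {poly cpoly K}) : subst_C (f * g) = subst_C f * subst_C g.
Proof. exact: subst_C_multiplicative.1. Qed.

Lemma subst_C1 : subst_C 1 = 1 :> {poly cpoly K}.
Proof. exact: subst_C_multiplicative.2. Qed.

Lemma subst_CX : subst_C 'X = 'X :> {poly cpoly K}.
Proof. by rewrite subst_CE map_polyX /horner_eval hornerX. Qed.

Lemma subst_C_Cvar k : subst_C (Cvar K k) = pvar K k *: 'X^k.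
Proof. by rewrite subst_CE map_polyC /horner_eval hornerC; apply: peval_pvar. Qed.

End SubstC.

(** The case [a l = l'] has no rule of its own: if [a l' != l], the third rule applies to the
    swapped permutation, and if [a l' = l], the swap does nothing. Two points in distinct cycles are
    never consecutive in a cycle, so the first rule carries no adjacency condition. *)
Record swap_rec (V : zmodType) (phi : forall m, 'S_m -> V) : Prop := {
  swap_rec_diff : forall m (a : 'S_m) (l l' : 'I_m),
    l' = l.+1 :> nat -> l' \notin porbit a l ->
    phi m a = phi m (tperm l l' * a * tperm l l')%g
              + phi _ (restr (tperm l l' * a)%g [set~ l'])
              - phi _ (restr (tperm l l' * a)%g [set~ l]);
  swap_rec_same : forall m (a : 'S_m) (l l' : 'I_m),
    l' = l.+1 :> nat -> l' \in porbit a l -> a l != l' -> a l' != l ->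
    phi m a = phi m (tperm l l' * a * tperm l l')%g;
  swap_rec_adj : forall m (a : 'S_m) (l l' : 'I_m),
    l' = l.+1 :> nat -> a l != l' -> a l' = l ->
    phi m a = phi m (tperm l l' * a * tperm l l')%g - phi _ (restr a [set~ l])
}.

Lemma mem_porbit1 (T : finType) (a : {perm T}) x : a x \in porbit a x.
Proof. by have := mem_porbit a 1 x; rewrite expg1. Qed.

Lemma card_del m (p : 'I_m) : (#|([set~ p] : {set 'I_m})|.+1 = m)%N.
Proof. by rewrite cardsC1 card_ord prednK //; case: m p => [[]|]. Qed.

Lemma sub_del m (q : 'I_m) c :
  (m - c.+1 = #|([set~ q] : {set 'I_m})| - c)%N.
Proof. by rewrite -[RHS]subSS card_del. Qed.

(** All correction terms live on [m - 1] points, where [phi] and [psi] agree by induction; hence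
    agreement at [a] and at the swapped permutation are equivalent. *)
Lemma swap_rec_unique (V : zmodType) (phi psi : forall m, 'S_m -> V) :
  swap_rec phi -> swap_rec psi ->
  (forall a : 'S_0, phi 0%N a = psi 0%N a) ->
  (forall k n (b : 'S_n), phi n b = psi n b ->
     phi _ (cat_perm (long_cycle k.+1) b) = psi _ (cat_perm (long_cycle k.+1) b)) ->
  forall m (a : 'S_m), phi m a = psi m a.
Proof.
move=> hphi hpsi e0 ecat; apply: swap_ind => // m a l l' el al IH.
have IHd c p : phi _ (restr c [set~ p : 'I_m]) = psi _ (restr c [set~ p]).
  by apply: IH; have := card_del p; lia.
have [adj|nadj] := eqVneq (a l') l.
  rewrite (swap_rec_adj hphi el al adj) (swap_rec_adj hpsi el al adj) IHd.
  by split=> [/addIr|->].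
have [same|diff] := boolP (l' \in porbit a l).
  by rewrite (swap_rec_same hphi el same al nadj) (swap_rec_same hpsi el same al nadj).
rewrite (swap_rec_diff hphi el diff) (swap_rec_diff hpsi el diff) !IHd.
by split=> [/addIr/addIr|->].
Qed.

(** The rules are additive in [phi]. This transports them along evaluations, the two embeddings into
    the tensor square, and the comultiplication. *)
Lemma swap_rec_raddf (V W : zmodType) (h : {additive V -> W})
    (phi : forall m, 'S_m -> V) :
  swap_rec phi -> swap_rec (fun m a => h (phi m a)).
Proof.
move=> H; split=> m a l l' el.
- by move=> d; rewrite (swap_rec_diff H el d) raddfB raddfD.
- by move=> s n1 n2; rewrite (swap_rec_same H el s n1 n2).
- by move=> n1 n2; rewrite (swap_rec_adj H el n1 n2) raddfB.
Qed.

Lemma ncycles_long_cycle k : ncycles (long_cycle k.+1) = 1%N.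
Proof.
have full x : x \in porbit (long_cycle k.+1) ord0.
  apply/porbitP; exists x; apply: ord_inj.
  by rewrite long_cycleX add0n modn_small.
rewrite /ncycles (_ : porbits _ = [set porbit (long_cycle k.+1) ord0]) ?cards1 //.
apply/setP => A; rewrite inE; apply/imsetP/eqP => [[x _ ->]|->].
  by apply/eqP; rewrite eq_porbit_mem.
by exists ord0.
Qed.

(** The cycle through [l'] and [l] continues to [a l], which lies outside the deleted pair, so no
    cycle disappears. *)
Lemma ncycles_adj m (a : 'S_m) l l' :
  a l != l' -> a l' = l -> ncycles (restr a (~: [set l; l'])) = ncycles a.
Proof.
move=> al al'; have all : a l \notin [set l; l'].
  rewrite !inE (negPf al) orbF -{2}al'; apply: contra al => /eqP/perm_inj el.
  by rewrite el al' el.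
rewrite /ncycles card_porbits_restr; apply: eq_card => A; rewrite inE.
apply/andb_idr => /imsetP[x _ ->]; apply/set0Pn.
have [|xU] := boolP (x \in [set l; l']); last first.
  by exists x; rewrite inE porbit_id inE.
rewrite !inE => /orP[/eqP->|/eqP->]; exists (a l).
  by rewrite inE mem_porbit1 inE.
rewrite 2!inE all andbT.
by apply: (@porbit_trans _ _ _ l); rewrite ?mem_porbit1 // -{1}al' mem_porbit1.
Qed.

Lemma ncycles_tpermL m (a : 'S_m) l l' : l != l' ->
  (ncycles a <= (ncycles (tperm l l' * a)%g).+1)%N.
Proof. by move=> /(ncycles_tperm a); case: (_ \notin _) => /=; lia. Qed.

Lemma ncycles_merge m (a : 'S_m) l l' : l' \notin porbit a l ->
  (ncycles (tperm l l' * a)%g).+1 = ncycles a.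
Proof.
move=> d; have ll' : l != l' by apply: contraNneq d => <-; apply: porbit_id.
by have := ncycles_tperm a ll'; rewrite d /= addn2 => -[].
Qed.

Lemma ncycles_split m (a : 'S_m) l l' : l != l' -> l' \in porbit a l ->
  ncycles (tperm l l' * a)%g = (ncycles a).+1.
Proof. by move=> ll' s; have := ncycles_tperm a ll'; rewrite s /= addn0. Qed.

Lemma ncycles_beta1 m (a : 'S_m) l l' : a l != l' ->
  ncycles (restr (tperm l l' * a)%g [set~ l']) = ncycles (tperm l l' * a)%g.
Proof. by move=> al; rewrite ncycles_del // permM tpermR. Qed.

Lemma ncycles_beta2 m (a : 'S_m) l l' : a l' != l ->
  ncycles (restr (tperm l l' * a)%g [set~ l]) = ncycles (tperm l l' * a)%g.
Proof. by move=> al; rewrite ncycles_del // permM tpermL. Qed.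

(** * Degree bound in N and the leading coefficient *)

Section LeadingCoefficient.
Variables (R : comNzRingType) (p : nat -> R) (W : forall m, 'S_m -> {poly R}).

Hypothesis W_empty : forall a : 'S_0, W a = 1.
Hypothesis W_cat : forall m n (a : 'S_m) (b : 'S_n), W (cat_perm a b) = W a * W b.
Hypothesis W_cycle : forall k, W (long_cycle k.+1) = p k *: 'X^k.
Hypothesis W_swap : forall m (a : 'S_m) (l l' : 'I_m),
  l' = l.+1 :> nat -> a l != l' -> a l' != l ->
  W a = W (tperm l l' * a * tperm l l')%g
        + W (restr (tperm l l' * a)%g [set~ l'])
        - W (restr (tperm l l' * a)%g [set~ l]).
Hypothesis W_adj : forall m (a : 'S_m) (l l' : 'I_m),
  l' = l.+1 :> nat -> a l != l' -> a l' = l ->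
  W a = W (tperm l l' * a * tperm l l')%g
        + p 0%N *: W (restr a (~: [set l; l']))
        - 'X * W (restr a [set~ l]).

(** That is, the degree in N is at most [m - c(a)]. A swap preserves [m] and [c(a)], so it suffices
    to bound the corrections: [tau * a] has at least [c(a) - 1] cycles and one point is then
    deleted; in the adjacent case the cycles are kept, on [m - 2] points, or on [m - 1] points with
    one extra factor N. *)
Lemma W_degree m (a : 'S_m) j :
  (m < j + ncycles a)%N -> (W a)`_j = 0.
Proof.
move: m a j; apply: swap_ind => [a j|k n b IH j|m a l l' el al IH].
- have := leq_ncycles a; rewrite leqn0 => /eqP->; rewrite addn0 => j0.
  by rewrite W_empty coef1 gtn_eqF.
- rewrite ncycles_cat ncycles_long_cycle => hj.
  rewrite W_cat W_cycle -scalerAl coefZ coefXnM; case: ifP => hk.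
    by rewrite mulr0.
  by rewrite IH ?mulr0 //; lia.
have ll' : l != l' by apply/eqP => /(congr1 val) /=; lia.
have m0 := leq_ltn_trans (leq0n l) (ltn_ord l).
suff E j : (m < j + ncycles a)%N ->
    (W a)`_j = (W (tperm l l' * a * tperm l l')%g)`_j.
  by split=> H j; [rewrite ncycles_tpermJ => hj; rewrite -E // H
                  |move=> hj; rewrite E // H // ncycles_tpermJ].
move=> hj; have IHd (c : 'S_m) q i : (m <= i + ncycles (restr c [set~ q]))%N ->
    (W (restr c [set~ q]))`_i = 0.
  move=> h; apply: IH; first exact: eq_leq (card_del q).
  exact: leq_trans (eq_leq (card_del q)) h.
have [adj|nadj] := eqVneq (a l') l.
  rewrite (W_adj el al adj) coefB coefD coefZ coefXM.
  have cU : #|(~: [set l; l'] : {set 'I_m})| = (m - 2)%N.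
    by rewrite cardsCs setCK cards2 ll' card_ord.
  have cp := ncycles_adj al adj.
  have -> : (W (restr a (~: [set l; l'])))`_j = 0.
    by apply: IH; [lia | rewrite cp cU; lia].
  rewrite mulr0 addr0; case: eqP => [_|/eqP j0]; first by rewrite subr0.
  have cl : ncycles (restr a [set~ l]) = ncycles a.
    by apply: ncycles_del; rewrite -{2}adj (inj_eq perm_inj).
  by rewrite IHd ?subr0 // cl; lia.
have c1 := ncycles_tpermL a ll'.
have cb1 := ncycles_beta1 al; have cb2 := ncycles_beta2 nadj.
rewrite (W_swap el al nadj) coefB coefD.
by rewrite !IHd ?cb1 ?cb2 ?subr0 ?addr0 //; lia.
Qed.

Lemma W_degree_del m (a : 'S_m) q j :
  (m <= j + ncycles (restr a [set~ q]))%N -> (W (restr a [set~ q]))`_j = 0.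
Proof. by move=> h; apply: W_degree; apply: leq_trans (eq_leq (card_del q)) h. Qed.

Definition lead m (a : 'S_m) : R := (W a)`_(m - ncycles a).

(** Compare coefficients of [N^(m - c(a))]. If [tau] merges two cycles, both corrections reach
    exactly this degree; if it splits one, they stay at least two degrees below. In the adjacent
    case the [C_1] term is too small and the N term contributes its leading coefficient. *)
Lemma lead_swap_rec : swap_rec lead.
Proof.
split=> m a l l' el.
all: have ll' : l != l' by apply/eqP => /(congr1 val) /=; lia.
all: have ml := card_del l; have ml' := card_del l'; have cm := leq_ncycles a.
- move=> d; have al : a l != l' by apply: contraNneq d => <-; apply: mem_porbit1.
  have al' : a l' != l.
    by rewrite porbit_sym in d; apply: contraNneq d => <-; apply: mem_porbit1.
  rewrite /lead (W_swap el al al') coefB coefD ncycles_tpermJ.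
  rewrite ncycles_beta1 // ncycles_beta2 //.
  have e q : (m - (ncycles a) = #|([set~ q] : {set 'I_m})| - ncycles (tperm l l' * a)%g)%N.
    by rewrite -(ncycles_merge d) (sub_del q).
  by rewrite -!e.
- move=> s al al'; have ct := ncycles_split ll' s.
  rewrite /lead {1}(W_swap el al al') coefB coefD ncycles_tpermJ.
  by rewrite !W_degree_del ?ncycles_beta1 ?ncycles_beta2 // ?ct ?subr0 ?addr0 //; lia.
- move=> al al'; rewrite /lead {1}(W_adj el al al') coefB coefD coefZ coefXM.
  have all : a l != l by rewrite -{2}al' (inj_eq perm_inj).
  have cd := ncycles_del all; have lt_c : (ncycles a < m)%N.
    rewrite -cd; apply: leq_trans (eq_leq ml).
    by rewrite ltnS; apply: leq_ncycles.
  have cU : #|(~: [set l; l'] : {set 'I_m})| = (m - 2)%N.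
    by rewrite cardsCs setCK cards2 ll' card_ord.
  have -> : (W (restr a (~: [set l; l'])))`_(m - ncycles a) = 0.
    by apply: W_degree; rewrite ncycles_adj // cU; lia.
  (* Multiplication by N shifts the coefficient index by one, which is legitimate since [m - c(a)]
     is positive. *)
  rewrite mulr0 addr0 ncycles_tpermJ cd subn_eq0 leqNgt lt_c /=.
  by rewrite -subnS (sub_del l).
Qed.

Lemma lead_empty (a : 'S_0) : lead a = 1.
Proof. by rewrite /lead sub0n W_empty coef1. Qed.

Lemma lead_cycle k : lead (long_cycle k.+1) = p k.
Proof.
by rewrite /lead ncycles_long_cycle subn1 W_cycle coefZ coefXn eqxx mulr1.
Qed.

Lemma lead_cat m n (a : 'S_m) (b : 'S_n) : lead (cat_perm a b) = lead a * lead b.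
Proof.
have ca := leq_ncycles a; have cb := leq_ncycles b.
rewrite /lead ncycles_cat W_cat coefM.
(* By the degree bounds only the product of the two leading coefficients reaches the total
   degree. *)
have lt_i : (m - ncycles a < (m + n - (ncycles a + ncycles b)).+1)%N by lia.
rewrite (bigD1 (Ordinal lt_i)) //= big1 ?addr0.
  by congr (_ * _`__); lia.
move=> i; rewrite -val_eqE /= => ni.
have [lt|le] := ltnP (m - ncycles a) i.
  by rewrite W_degree ?mul0r //; lia.
by rewrite [(W b)`__]W_degree ?mulr0 //; lia.
Qed.

End LeadingCoefficient.

Section LeadingGl.
Variables (K : fieldType) (w : weight_system K).
Hypothesis w_gl : is_wgl w.

Let W m (a : 'S_m) : {poly cpoly K} := subst_C (w a).

Let W_empty (a : 'S_0) : W a = 1.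
Proof. by rewrite /W (wgl_empty w_gl) subst_C1. Qed.

Let W_cat m n (a : 'S_m) (b : 'S_n) : W (cat_perm a b) = W a * W b.
Proof. by rewrite /W (wgl_cat w_gl) subst_CM. Qed.

Let W_cycle k : W (long_cycle k.+1) = pvar K k *: 'X^k.
Proof. by rewrite /W (wgl_cycle w_gl) subst_C_Cvar. Qed.

Let W_swap m (a : 'S_m) (l l' : 'I_m) :
  l' = l.+1 :> nat -> a l != l' -> a l' != l ->
  W a = W (tperm l l' * a * tperm l l')%g
        + W (restr (tperm l l' * a)%g [set~ l'])
        - W (restr (tperm l l' * a)%g [set~ l]).
Proof.
by move=> el n1 n2; rewrite /W (wgl_swap w_gl el n1 n2) subst_CB subst_CD.
Qed.

Let W_adj m (a : 'S_m) (l l' : 'I_m) :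
  l' = l.+1 :> nat -> a l != l' -> a l' = l ->
  W a = W (tperm l l' * a * tperm l l')%g
        + pvar K 0 *: W (restr a (~: [set l; l']))
        - 'X * W (restr a [set~ l]).
Proof.
move=> el n1 n2; rewrite /W (wgl_swap_adj w_gl el n1 n2).
rewrite subst_CB subst_CD !subst_CM subst_CX subst_C_Cvar expr0.
by rewrite -scalerAl mul1r.
Qed.

Definition X0 m (a : 'S_m) : cpoly K := lead W a.

(** For [k = 0] the exponent of N is 0, and [m - c(a) >= 0] selects the [Posz] branch without
    truncation. *)
Lemma Xcoef0E m (a : 'S_m) : Xcoef w 0 a = X0 a.
Proof.
rewrite /Xcoef /prechromatic muln0 oppr0 add0r /X0 /lead.
by rewrite (subzn (leq_ncycles a)).
Qed.

Lemma X0_swap_rec : swap_rec X0.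
Proof. exact: (lead_swap_rec W_empty W_cat W_cycle W_swap W_adj). Qed.

Lemma X0_empty (a : 'S_0) : X0 a = 1.
Proof. exact: lead_empty. Qed.

Lemma X0_cycle k : X0 (long_cycle k.+1) = pvar K k.
Proof. exact: lead_cycle. Qed.

Lemma X0_cat m n (a : 'S_m) (b : 'S_n) : X0 (cat_perm a b) = X0 a * X0 b.
Proof. exact: (lead_cat W_empty W_cat W_cycle W_swap W_adj). Qed.

End LeadingGl.

(** * Convolution *)

Lemma sperm_congr (V : Type) (phi : forall m, 'S_m -> V) m n (a : 'S_m) (b : 'S_n) :
  Sperm a = Sperm b -> phi m a = phi n b.
Proof. by move=> e; have := congr1 (fun s : sperm => phi (tag s) (tagged s)) e. Qed.

(** Makes the adjacent swap increasing on every set that does not contain both [l] and [l']. *)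
Lemma tperm_lt m (l l' x y : 'I_m) : l' = l.+1 :> nat ->
  ~~ ((x == l) && (y == l')) -> (x < y)%N -> (tperm l l' x < tperm l l' y)%N.
Proof.
move=> el; rewrite -!val_eqE /= => n lt_xy.
have eqn (i j : 'I_m) : i <> j -> i != j :> nat by move=> h; apply/eqP => /ord_inj.
case: tpermP => [ex|ex|/eqn nx1 /eqn nx2]; case: tpermP => [ey|ey|/eqn ny1 /eqn ny2];
  subst; move: n; rewrite ?eqxx /=; lia.
Qed.

(** Colorings of the cycles of [a] are encoded as invariant functions on the points, so that
    colorings of different permutations share one type. *)
Definition cycle_inv m (a : 'S_m) (T : eqType) (f : 'I_m -> T) : bool :=
  [forall x, f (a x) == f x].

(** * Color classes under an adjacent swap *)

Section Fibers.
Variables (m : nat) (C : finType).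
Implicit Types (a b : 'S_m) (f : {ffun 'I_m -> C}) (l p x : 'I_m) (k : C).

Definition fiber f k : {set 'I_m} := [set x | f x == k].

Lemma cycle_invP a f : reflect (forall x, f (a x) = f x) (cycle_inv a f).
Proof. exact: 'forall_eqP. Qed.

Lemma fiber_inv a f k y : cycle_inv a f -> (a y \in fiber f k) = (y \in fiber f k).
Proof. by move=> /cycle_invP fa; rewrite !inE fa. Qed.

Lemma cycle_inv_porbit a f x y : cycle_inv a f -> y \in porbit a x -> f y = f x.
Proof.
move=> /cycle_invP fa /porbitP[k ->].
by elim: k => [|k IH]; rewrite ?expg0 ?perm1 // expgSr permM fa.
Qed.

Variables (l l' : 'I_m).
Hypothesis el : l' = l.+1 :> nat.
Let tau := tperm l l'.

Lemma adjacent_neq : l != l'. Proof. by rewrite -val_eqE /= el; lia. Qed.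

Lemma tperm_fix f x : f l = f l' -> f (tau x) = f x.
Proof. by rewrite /tau; case: tpermP => [->|->|]. Qed.

Lemma cycle_inv_tpermJ a f : f l = f l' ->
  cycle_inv (tau * a * tau)%g f = cycle_inv a f.
Proof.
move=> fl; apply/cycle_invP/cycle_invP => fa x.
  have := fa (tau x); rewrite !permM tpermK !tperm_fix //.
by rewrite !permM tperm_fix // fa tperm_fix.
Qed.

Lemma cycle_inv_tpermM a f : f l = f l' ->
  cycle_inv (tau * a)%g f = cycle_inv a f.
Proof.
move=> fl; apply/cycle_invP/cycle_invP => fa x.
  by have := fa (tau x); rewrite !permM tpermK !tperm_fix.
by rewrite !permM fa tperm_fix.
Qed.

Definition fswap f : {ffun 'I_m -> C} := [ffun x => f (tau x)].

Lemma fswapK : involutive fswap.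
Proof. by move=> f; apply/ffunP => x; rewrite !ffunE tpermK. Qed.

Lemma cycle_inv_fswap a f : cycle_inv (tau * a * tau)%g (fswap f) = cycle_inv a f.
Proof.
apply/cycle_invP/cycle_invP => fa x; last by rewrite !ffunE !permM tpermK fa.
by have := fa (tau x); rewrite !ffunE !permM !tpermK.
Qed.

(** When [l] and [l'] have different colors, no color class contains both, and [tau] is an
    order-preserving relabelling of each class. *)
Lemma restr_fswap a f k : cycle_inv a f -> f l != f l' ->
  Sperm (restr (tau * a * tau)%g (fiber (fswap f) k)) = Sperm (restr a (fiber f k)).
Proof.
move=> fa nl; apply: (@sperm_eq_of_copies m _ _ _ _ (@enum_val _ (mem (fiber (fswap f) k)))
   (fun i => tau (@enum_val _ (mem (fiber f k)) i)) (tau * a * tau)%g).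
- exact: enum_val_increasing.
- move=> x y /(@enum_val_increasing _ (fiber f k)); apply: tperm_lt => //.
  apply/andP => -[/eqP e1 /eqP e2]; have := enum_valP x; have := enum_valP y.
  by rewrite e1 e2 !inE => /eqP e3 /eqP e4; move: nl; rewrite e3 e4 eqxx.
- move=> x; rewrite codom_enum_val inE ffunE; apply/idP/codomP => [h|[y ->]].
    have [|y ey] := @enum_val_ex _ (fiber f k) (tau x); first by rewrite inE.
    by exists y; rewrite ey tpermK.
  by rewrite tpermK; have := enum_valP y; rewrite inE.
- by move=> x; rewrite enum_val_restr_inv // => y; rewrite fiber_inv // cycle_inv_fswap.
- move=> x; rewrite enum_val_restr_inv; last by move=> y; rewrite fiber_inv.
  by rewrite !permM tpermK.
Qed.

Lemma fiber_avoid f k x p : f p != k -> x \in fiber f k -> p != x.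
Proof. by move=> h; rewrite inE => /eqP e; apply: contraNneq h => ->; apply/eqP. Qed.

Lemma restr_eq a b (U V : {set 'I_m}) (F : 'I_m -> 'I_m) : U = V ->
  (forall i, enum_val (restr a U i) = F (enum_val i)) ->
  (forall i, enum_val (restr b V i) = F (enum_val i)) ->
  Sperm (restr a U) = Sperm (restr b V).
Proof.
move=> -> ha hb; apply: sperm_eq_of_copies ha hb => //; exact: enum_val_increasing.
Qed.

Lemma restr_tpermJ_other a f k : cycle_inv a f -> f l = f l' -> f l != k ->
  Sperm (restr (tau * a * tau)%g (fiber f k)) = Sperm (restr a (fiber f k)).
Proof.
move=> fa fl nk; have nk' : f l' != k by rewrite -fl.
apply: (@restr_eq _ _ _ _ a) => // i; last first.
  by rewrite enum_val_restr_inv // => y; rewrite fiber_inv.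
rewrite enum_val_restr_inv => [|y]; last by rewrite fiber_inv ?cycle_inv_tpermJ.
have iU := enum_valP i; have aU : a (enum_val i) \in fiber f k by rewrite fiber_inv.
by rewrite !permM !tpermD // (fiber_avoid nk, fiber_avoid nk').
Qed.

(** A class of another color contains neither [l] nor [l'], so it sees neither the factor [s] nor
    the deletion. The choice [s = tau] serves the rule for distinct cycles, [s = 1] the adjacent
    one. *)
Lemma restr_del_other a s p f k : s = 1%g \/ s = tau -> p = l \/ p = l' ->
  cycle_inv a f -> f l = f l' -> f l != k ->
  Sperm (restr (s * a)%g (fiber f k :\ p)) = Sperm (restr a (fiber f k)).
Proof.
move=> hs hp fa fl nk; have nk' : f l' != k by rewrite -fl.
have pN : p \notin fiber f k by rewrite inE; case: hp => ->.
have sa : cycle_inv (s * a)%g f.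
  by case: hs => ->; rewrite ?mul1g // cycle_inv_tpermM.
have E : fiber f k :\ p = fiber f k.
  by apply/setP => x; rewrite in_setD1; case: eqP => [->|//]; rewrite (negPf pN).
apply: (@restr_eq _ _ _ _ a) => // i; last first.
  by rewrite enum_val_restr_inv // => y; rewrite fiber_inv.
have iU := enum_valP i; rewrite {2}E in iU.
rewrite enum_val_restr_del => [|y]; last by rewrite fiber_inv.
have se : (s * a)%g (enum_val i) = a (enum_val i).
  rewrite permM; case: hs => ->; rewrite ?perm1 // tpermD //.
    exact: fiber_avoid iU.
  exact: fiber_avoid iU.
rewrite /del se; case: eqP => // e.
by have := fiber_inv k (enum_val i) fa; rewrite e iU (negPf pN).
Qed.

(** Nothing lies between [l] and [l + 1], so the two points remain neighbours after the class is
    renumbered. *)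
Lemma adjacent_in_fiber f (U := fiber f (f l)) : f l = f l' ->
  exists lU l'U : 'I_#|U|,
  [/\ enum_val lU = l, enum_val l'U = l' & l'U = lU.+1 :> nat].
Proof.
move=> fl; have [lU eU] : exists lU : 'I_#|U|, enum_val lU = l by apply: enum_val_ex; rewrite inE.
have [l'U eU'] : exists lU : 'I_#|U|, enum_val lU = l'.
  by apply: enum_val_ex; rewrite inE fl.
exists lU, l'U; split => //.
have lt : (lU < l'U)%N.
  rewrite ltnNge leq_eqVlt; apply/negP => /orP[/eqP/ord_inj e|].
    by move: adjacent_neq; rewrite -eU -eU' e eqxx.
  by move/(@enum_val_increasing _ U); rewrite eU eU' el; lia.
apply/eqP; rewrite eqn_leq lt andbT leqNgt; apply/negP => lt2.
have ltz : (lU.+1 < #|U|)%N by apply: ltn_trans (ltn_ord l'U).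
have h1 : (lU < Ordinal ltz)%N by [].
have h2 : (Ordinal ltz < l'U)%N by [].
have := enum_val_increasing h1; have := enum_val_increasing h2.
by rewrite eU eU' el; lia.
Qed.

Section SameFiber.
Variables (a : 'S_m) (f : {ffun 'I_m -> C}).
Hypotheses (fa : cycle_inv a f) (fl : f l = f l').
Let U := fiber f (f l).
Let b := restr a U.
Let aU y : (a y \in U) = (y \in U). Proof. exact: fiber_inv. Qed.

Variables (lU l'U : 'I_#|U|).
Hypotheses (eU : enum_val lU = l) (eU' : enum_val l'U = l').

Lemma enum_val_tperm i : enum_val (tperm lU l'U i) = tau (enum_val i).
Proof. by rewrite (inj_tperm _ _ _ (@enum_val_inj _ (mem U))) eU eU'. Qed.

Lemma restr_tpermJ_same :
  restr (tau * a * tau)%g U = (tperm lU l'U * b * tperm lU l'U)%g.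
Proof.
apply/permP => i; apply: (@enum_val_inj _ (mem U)).
rewrite enum_val_restr_inv => [|y]; last by rewrite fiber_inv ?cycle_inv_tpermJ.
by rewrite !permM enum_val_tperm enum_val_restr_inv // enum_val_tperm.
Qed.

(** Identifies the correction terms of the swap rules for the restriction [b] with restrictions
    taken inside ['I_m]; [s] and [sU] will be either both the identity or the corresponding
    transpositions. *)
Lemma restr_del_same (s : 'S_m) (sU : 'S_#|U|) p pU :
  (forall y, ((s * a)%g y \in U) = (y \in U)) ->
  (forall i, enum_val (sU i) = s (enum_val i)) ->
  enum_val pU = p ->
  Sperm (restr (sU * b)%g [set~ pU]) = Sperm (restr (s * a)%g (U :\ p)).
Proof.
move=> sU_inv hs ep; apply: (@sperm_eq_of_copies m _ _ _ _
   (fun i => @enum_val _ (mem U) (@enum_val _ (mem [set~ pU]) i))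
   (@enum_val _ (mem (U :\ p))) (del (s * a)%g p)).
- by apply: increasing_comp; apply: enum_val_increasing.
- exact: enum_val_increasing.
- move=> x; rewrite codom_enum_val in_setD1; apply/codomP/andP => [[y ->]|[np xU]].
    rewrite enum_valP -ep (inj_eq (@enum_val_inj _ (mem U))).
    by have := enum_valP y; rewrite !inE.
  have [z ez] := enum_val_ex xU.
  have [|y ey] := @enum_val_ex _ [set~ pU] z; last by exists y; rewrite ey.
  by rewrite !inE; apply: contraNneq np => e; rewrite -ez e ep.
- move=> x; rewrite enum_val_restr1 /del !permM.
  rewrite -ep -(inj_eq (@enum_val_inj _ (mem U))) enum_val_restr_inv // hs.
  by case: ifP => _; rewrite enum_val_restr_inv // hs.
- by move=> x; rewrite enum_val_restr_del.
Qed.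

End SameFiber.

End Fibers.

(** Otherwise each of two successive multiplications by the transposition would lose a cycle,
    although its square is 1. *)
Lemma mem_porbit_tperm m (a : 'S_m) l l' :
  l' \notin porbit a l -> l' \in porbit (tperm l l' * a)%g l.
Proof.
move=> d; apply: contraT => d'; have := ncycles_merge d; have := ncycles_merge d'.
by rewrite mulgA tperm2 mul1g; lia.
Qed.

(** * Stability of the swap rules under convolution *)

Section Convolution.
Variables (A : comNzRingType) (C : finType) (phi : C -> forall m, 'S_m -> A).

Definition colored m (a : 'S_m) (f : {ffun 'I_m -> C}) : A :=
  \prod_k phi k (restr a (fiber f k)).

Definition colored_del m (a : 'S_m) p (f : {ffun 'I_m -> C}) : A :=
  \prod_k phi k (restr a (fiber f k :\ p)).

(* The convolution product of the functions [phi k] for the comultiplication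
   that splits the set of cycles of [a]: [f] attaches a factor to each cycle. *)
Definition conv m (a : 'S_m) : A :=
  \sum_(f : {ffun 'I_m -> C} | cycle_inv a f) colored a f.

(** Since [p] is not fixed, deleting it loses no cycle: colorings of the restriction extend uniquely
    to [a], with [p] receiving the color of its predecessor [q]. *)
Lemma conv_del m (a : 'S_m) p : a p != p ->
  conv (restr a [set~ p]) =
  \sum_(f : {ffun 'I_m -> C} | cycle_inv a f) colored_del a p f.
Proof.
move=> ap; pose q := (a^-1)%g p.
have qp : q != p by apply: contraNneq ap => e; rewrite -{1}e permKV.
(* [to] retracts all points onto those different from [p], sending [p] to its predecessor in the
   same cycle. *)
have inD x : (if x == p then q else x) \in [set~ p].
  by rewrite !inE; have [_|] := eqVneq x p.
pose to x := enum_rank_in (inD x) (if x == p then q else x).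
have toK x : enum_val (to x) = if x == p then q else x.
  by rewrite /to enum_rankK_in.
have toV i : to (enum_val i) = i.
  apply: (@enum_val_inj _ (mem [set~ p])); rewrite toK ifN //.
  by have := enum_valP i; rewrite !inE.
pose h (g : {ffun 'I_#|[set~ p]| -> C}) := [ffun x => g (to x)].
pose h' (f : {ffun 'I_m -> C}) := [ffun i : 'I_#|[set~ p]| => f (enum_val i)].
have hK g : h' (h g) = g by apply/ffunP => i; rewrite !ffunE toV.
have delK i : to (del a p (enum_val i)) = restr a [set~ p] i.
  by rewrite -enum_val_restr1 toV.
have inv_h g : cycle_inv a (h g) = cycle_inv (restr a [set~ p]) g.
  apply/cycle_invP/cycle_invP => [hg i|hg x].
    rewrite -delK -[g (to _)](ffunE (fun x => g (to x))) -/(h g) /del.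
    case: eqP => [e|_]; last by rewrite hg ffunE toV.
    rewrite hg -[RHS](congr1 g (toV i)) -[RHS](ffunE (fun x => g (to x))) -/(h g).
    by rewrite -(hg (enum_val i)) e.
  have toP : h g p = h g q by rewrite !ffunE /to; congr (g _);
    apply: (@enum_val_inj _ (mem [set~ p])); rewrite !toK eqxx (negPf qp).
  have step y : y != p -> h g (del a p y) = h g y.
    move=> yp; rewrite !ffunE; have [|i ei] := @enum_val_ex _ [set~ p] y.
      by rewrite !inE.
    by rewrite -ei delK hg toV.
  have [->|xp] := eqVneq x p.
    by rewrite toP -[RHS]step // /del /q permKV eqxx.
  rewrite -[RHS]step // /del; case: eqP => // e.
  have -> : a x = p by [].
  by rewrite -[LHS]/(h g p) toP -[LHS]step // /del /q permKV eqxx.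
rewrite (reindex_onto h h'); last first.
  move=> f /cycle_invP fa; apply/ffunP => x; rewrite !ffunE toK.
  by case: eqP => // ->; rewrite -fa permKV.
apply: eq_big => [g|g]; first by rewrite inv_h hK eqxx andbT.
rewrite -inv_h => hg; apply: eq_bigr => k _; apply: sperm_congr.
have hg' : cycle_inv (restr a [set~ p]) g by rewrite -inv_h.
apply: (@sperm_eq_of_copies m _ _ _ _
   (fun i => @enum_val _ (mem [set~ p]) (@enum_val _ (mem (fiber g k)) i))
   (@enum_val _ (mem (fiber (h g) k :\ p))) (del a p)).
- by apply: increasing_comp; apply: enum_val_increasing.
- exact: enum_val_increasing.
- move=> x; rewrite codom_enum_val in_setD1 inE; apply/codomP/andP => [[y ->]|[np xU]].
    have := enum_valP y; have := enum_valP (enum_val y).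
    by rewrite !inE ffunE toV => -> ->.
  have [|y ey] := @enum_val_ex _ [set~ p] x; first by rewrite !inE.
  have [|z ez] := @enum_val_ex _ (fiber g k) y; last by exists z; rewrite ez.
  by move: xU; rewrite -ey ffunE toV inE.
- move=> x; rewrite -enum_val_restr1; congr enum_val; rewrite enum_val_restr_inv // => y.
  by rewrite fiber_inv.
- by move=> x; rewrite enum_val_restr_del // => y; rewrite fiber_inv.
Qed.

Hypothesis phi_rec : forall k, swap_rec (phi k).

Section Swap.
Variables (m : nat) (a : 'S_m) (l l' : 'I_m).
Hypothesis el : l' = l.+1 :> nat.
Let tau := tperm l l'.

(** Colorings separating [l] from [l'] are matched by [fswap] with equal summands, so only those
    with [f l = f l'] contribute to the difference; these are invariant under [a] exactly when they
    are under the swapped permutation. *)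
Lemma conv_tpermJ :
  conv a = conv (tau * a * tau)%g
    + \sum_(f : {ffun 'I_m -> C} | cycle_inv a f && (f l == f l'))
        (colored a f - colored (tau * a * tau)%g f).
Proof.
rewrite /conv (bigID (fun f : {ffun 'I_m -> C} => f l == f l')) /=.
rewrite [X in _ = X + _](bigID (fun f : {ffun 'I_m -> C} => f l == f l')) /=.
rewrite sumrB.
have -> : \sum_(f : {ffun 'I_m -> C} | cycle_inv (tau * a * tau)%g f && (f l == f l'))
            colored (tau * a * tau)%g f
        = \sum_(f : {ffun 'I_m -> C} | cycle_inv a f && (f l == f l')) colored (tau * a * tau)%g f.
  apply: eq_bigl => f; rewrite andbC [RHS]andbC; apply: andb_id2l => /eqP.
  exact: cycle_inv_tpermJ.
have -> : \sum_(f : {ffun 'I_m -> C} | cycle_inv (tau * a * tau)%g f && (f l != f l'))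
            colored (tau * a * tau)%g f
        = \sum_(f : {ffun 'I_m -> C} | cycle_inv a f && (f l != f l')) colored a f.
  rewrite (reindex_inj (can_inj (@fswapK m C l l'))) /=.
  apply: eq_big => [f|f /andP[]].
    by rewrite cycle_inv_fswap !ffunE tpermL tpermR [f l' == _]eq_sym.
  rewrite cycle_inv_fswap !ffunE tpermL tpermR eq_sym => fa nl.
  by apply: eq_bigr => k _; apply: sperm_congr; apply: restr_fswap.
by rewrite addrACA -[in RHS]addrA; ring.
Qed.

Section SameColor.
Variable f : {ffun 'I_m -> C}.
Hypotheses (fa : cycle_inv a f) (fl : f l = f l').
Let U := fiber f (f l).
Let rest := \prod_(k | k != f l) phi k (restr a (fiber f k)).

(** Isolates the factor of the common color of [l] and [l']; the product [rest] over the other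
    colors is shared by all terms of a swap rule. *)
Lemma colored_split : colored a f = phi (f l) (restr a U) * rest.
Proof. by rewrite /colored (bigD1 (f l)). Qed.

Lemma colored_tpermJ_split :
  colored (tau * a * tau)%g f = phi (f l) (restr (tau * a * tau)%g U) * rest.
Proof.
rewrite /colored (bigD1 (f l)) //=; congr (_ * _); apply: eq_bigr => k nk.
by apply: sperm_congr; apply: restr_tpermJ_other; rewrite // eq_sym.
Qed.

Lemma colored_del_split s p : s = 1%g \/ s = tau -> p = l \/ p = l' ->
  colored_del (s * a)%g p f = phi (f l) (restr (s * a)%g (U :\ p)) * rest.
Proof.
move=> hs hp; rewrite /colored_del (bigD1 (f l)) //=; congr (_ * _).
apply: eq_bigr => k nk.
by apply: sperm_congr; apply: restr_del_other hs hp fa fl _; rewrite eq_sym.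
Qed.

End SameColor.

(** The rule for [phi (f l)] is applied within the color class of [l], where [l] and [l'] are still
    adjacent and in distinct cycles. *)
Lemma colored_diff (f : {ffun 'I_m -> C}) : cycle_inv a f -> f l = f l' -> l' \notin porbit a l ->
  colored a f - colored (tau * a * tau)%g f =
  colored_del (tau * a)%g l' f - colored_del (tau * a)%g l f.
Proof.
move=> fa fl d; have [lU [l'U [eU eU' ee]]] := adjacent_in_fiber el fl.
rewrite colored_split // colored_tpermJ_split // !colored_del_split; try by auto.
rewrite -!mulrBl; congr (_ * _).
rewrite (restr_tpermJ_same fa fl eU eU') (swap_rec_diff (phi_rec _) ee); last first.
  by rewrite porbit_restr eU eU'.
have tauU y : ((tau * a)%g y \in fiber f (f l)) = (y \in fiber f (f l)).
  by apply: fiber_inv; rewrite cycle_inv_tpermM.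
have E := restr_del_same fa tauU (enum_val_tperm eU eU').
rewrite (sperm_congr (phi (f l)) (E _ _ eU)) (sperm_congr (phi (f l)) (E _ _ eU')).
by ring.
Qed.

Lemma colored_same (f : {ffun 'I_m -> C}) : cycle_inv a f -> f l = f l' -> l' \in porbit a l ->
  a l != l' -> a l' != l -> colored a f = colored (tau * a * tau)%g f.
Proof.
move=> fa fl s n1 n2; have [lU [l'U [eU eU' ee]]] := adjacent_in_fiber el fl.
rewrite colored_split // colored_tpermJ_split //; congr (_ * _).
have aU y : (a y \in fiber f (f l)) = (y \in fiber f (f l)) by apply: fiber_inv.
rewrite (restr_tpermJ_same fa fl eU eU') (swap_rec_same (phi_rec _) ee) //.
- by rewrite porbit_restr eU eU'.
- by rewrite -(inj_eq (@enum_val_inj _ _)) enum_val_restr_inv // eU eU'.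
- by rewrite -(inj_eq (@enum_val_inj _ _)) enum_val_restr_inv // eU eU'.
Qed.

Lemma colored_adj (f : {ffun 'I_m -> C}) : cycle_inv a f -> f l = f l' -> a l != l' -> a l' = l ->
  colored a f - colored (tau * a * tau)%g f = - colored_del a l f.
Proof.
move=> fa fl n1 n2; have [lU [l'U [eU eU' ee]]] := adjacent_in_fiber el fl.
have aU y : (a y \in fiber f (f l)) = (y \in fiber f (f l)) by apply: fiber_inv.
have := colored_del_split fa fl (or_introl erefl) (or_introl erefl).
rewrite mul1g => ->; rewrite colored_split // colored_tpermJ_split //.
rewrite -mulrBl -mulNr; congr (_ * _).
rewrite (restr_tpermJ_same fa fl eU eU') (swap_rec_adj (phi_rec _) ee).
- have aU1 y : ((1 * a)%g y \in fiber f (f l)) = (y \in fiber f (f l)).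
    by rewrite mul1g.
  have sU i : enum_val ((1 : 'S_#|fiber f (f l)|)%g i) = (1 : 'S_m)%g (enum_val i).
    by rewrite !perm1.
  have := restr_del_same fa aU1 sU eU; rewrite !mul1g => /(sperm_congr (phi (f l)))->.
  by rewrite addrAC subrr sub0r.
- by rewrite -(inj_eq (@enum_val_inj _ _)) enum_val_restr_inv // eU eU'.
- by apply: (@enum_val_inj _ _); rewrite enum_val_restr_inv // eU eU'.
Qed.

End Swap.

(** Apply the rule of each [phi k] inside the color class containing [l] and [l']. The colorings
    that give both points the same color are those of [tau * a] in the first rule and all colorings
    of [a] in the third. *)
Lemma conv_swap_rec : swap_rec conv.
Proof.
split=> m a l l' el.
- move=> d; rewrite (conv_tpermJ a el) -addrA; congr (_ + _).
  have al : a l != l' by apply: contraNneq d => <-; apply: mem_porbit1.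
  have al' : a l' != l.
    by rewrite porbit_sym in d; apply: contraNneq d => <-; apply: mem_porbit1.
  rewrite !conv_del ?permM ?tpermL ?tpermR // -sumrB; apply: eq_big => [f|f].
    apply/andP/idP => [[fa /eqP fl]|fa]; first by rewrite cycle_inv_tpermM.
    (* Multiplication by [tau] has joined the cycles of [l] and [l'], so a coloring of [tau * a]
       cannot separate them. *)
    have fl : f l = f l'.
      by apply/esym; apply: (cycle_inv_porbit fa); apply: mem_porbit_tperm.
    by rewrite -(cycle_inv_tpermM a fl) fa fl.
  by case/andP => fa /eqP fl; rewrite colored_diff.
- move=> s n1 n2; rewrite (conv_tpermJ a el) big1 ?addr0 // => f /andP[fa /eqP fl].
  by rewrite (colored_same el fa fl s n1 n2) subrr.
- move=> n1 n2; rewrite (conv_tpermJ a el) conv_del; last first.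
    by rewrite -{2}n2 (inj_eq perm_inj) (adjacent_neq el).
  rewrite -sumrN; congr (_ + _); apply: eq_big => [f|f]; last first.
    by case/andP => fa /eqP fl; apply: colored_adj.
  apply/andP/idP => [[]//|fa]; split=> //.
  by have /cycle_invP/(_ l') := fa; rewrite n2 => ->.
Qed.

End Convolution.

Section ConvolutionValues.
Variables (A : comNzRingType) (C : finType) (phi : C -> forall m, 'S_m -> A).

Lemma conv_empty (a : 'S_0) : (forall k (b : 'S_0), phi k b = 1) -> conv phi a = 1.
Proof.
move=> phi1; have phi1' k n (b : 'S_n) : n = 0%N -> phi k b = 1.
  by move=> en; subst n; apply: phi1.
rewrite /conv (big_pred1 [ffun x : 'I_0 => match notF (ltn_ord x) with end]).
  rewrite /colored big1 // => k _; apply: phi1'.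
  by apply/eqP; rewrite -leqn0 -[X in (_ <= X)%N](card_ord 0) max_card.
move=> f /=; rewrite (_ : f == _); last by apply/eqP/ffunP => -[].
by apply/cycle_invP => -[].
Qed.

(** A coloring of the concatenation is a color [c] for the new cycle together with a coloring of
    [b]. The class of [c] gains the standard cycle in front, hence the factor [v c]; the other
    classes are only shifted. *)
Lemma conv_cat_cycle (v : C -> A) j n (b : 'S_n) :
  (forall c i (d : 'S_i),
     phi c (cat_perm (long_cycle j.+1) d) = v c * phi c d) ->
  conv phi (cat_perm (long_cycle j.+1) b) = (\sum_c v c) * conv phi b.
Proof.
move=> phi_cat; set s := long_cycle j.+1; set a := cat_perm s b.
pose h (cg : C * {ffun 'I_n -> C}) : {ffun 'I_(j.+1 + n) -> C} :=
  [ffun x => match split x with inl _ => cg.1 | inr y => cg.2 y end].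
pose h' (f : {ffun 'I_(j.+1 + n) -> C}) :=
  (f (lshift n ord0), [ffun y => f (rshift j.+1 y)]).
have hL cg x : h cg (lshift n x) = cg.1.
  by rewrite ffunE -[lshift n x]/(unsplit (inl x)) unsplitK.
have hR cg x : h cg (rshift j.+1 x) = cg.2 x.
  by rewrite ffunE -[rshift j.+1 x]/(unsplit (inr x)) unsplitK.
have hK cg : h' (h cg) = cg.
  rewrite /h' hL; case: cg => c g; congr pair.
  by apply/ffunP => y; rewrite ffunE hR.
rewrite [LHS](reindex_onto h h'); last first.
  move=> f fa; apply/ffunP => x; case: (split_ordP x) => y ->.
    rewrite hL; apply/esym/(cycle_inv_porbit fa).
    rewrite porbit_catL imset_f //; apply/porbitP; exists y; apply: ord_inj.
    by rewrite long_cycleX add0n modn_small.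
  by rewrite hR ffunE.
rewrite mulr_suml (eq_bigl (fun cg : C * {ffun 'I_n -> C} => cycle_inv b cg.2)); last first.
  move=> cg /=; rewrite hK eqxx andbT.
  apply/cycle_invP/cycle_invP => hf x.
    by have := hf (rshift j.+1 x); rewrite cat_permR !hR.
  by case: (split_ordP x) => y ->; rewrite ?cat_permL ?cat_permR ?hL ?hR.
rewrite -(pair_big_dep xpredT (fun _ (g : {ffun 'I_n -> C}) => cycle_inv b g)
            (fun c g => colored phi a (h (c, g)))) /=.
apply: eq_bigr => c _; rewrite /conv mulr_sumr; apply: eq_bigr => g gb.
rewrite /colored (bigD1 c) //= [in RHS](bigD1 c) //= mulrA -phi_cat.
have ga : cycle_inv a (h (c, g)).
  apply/cycle_invP => x; case: (split_ordP x) => y ->.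
    by rewrite cat_permL !hL.
  by rewrite cat_permR !hR; apply: (elimT (cycle_invP _ _) gb).
congr (_ * _).
  apply: sperm_congr.
  apply: (@sperm_eq_of_copies (j.+1 + n) _ _ _ _
     (@enum_val _ (mem (fiber (h (c, g)) c)))
     (fun x : 'I_(j.+1 + #|fiber g c|) => match split x with
        | inl y => lshift n y
        | inr y => rshift j.+1 (@enum_val _ (mem (fiber g c)) y) end) a).
  - exact: enum_val_increasing.
  - move=> x y; case: (split_ordP x) => x' ->; case: (split_ordP y) => y' -> //=.
    + by have := ltn_ord x'; lia.
    + by move=> lt; have := ltn_ord y'; lia.
    + by rewrite !ltn_add2l; apply: enum_val_increasing.
  - move=> x; rewrite codom_enum_val inE; apply/idP/codomP => [|[y ->]].
      case: (split_ordP x) => y ->; first by exists (lshift _ y); rewrite (unsplitK (inl _)).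
      rewrite hR /= => gy; have [|z <-] := @enum_val_ex _ (fiber g c) y.
        by rewrite inE.
      by exists (rshift _ z); rewrite (unsplitK (inr _)).
    case: (split_ordP y) => z _ /=; rewrite ?hL ?hR //=.
    by have := enum_valP z; rewrite inE.
  - by move=> x; rewrite enum_val_restr_inv // => y; rewrite fiber_inv.
  - move=> x; case: (split_ordP x) => y ->; rewrite ?cat_permL ?cat_permR.
      by rewrite (unsplitK (inl _)).
    rewrite (unsplitK (inr _)) enum_val_restr_inv // => z.
    by rewrite fiber_inv.
apply: eq_bigr => k kc; apply: sperm_congr.
apply: (@sperm_eq_of_copies (j.+1 + n) _ _ _ _
   (@enum_val _ (mem (fiber (h (c, g)) k)))
   (fun x : 'I_#|fiber g k| => rshift j.+1 (@enum_val _ (mem (fiber g k)) x)) a).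
- exact: enum_val_increasing.
- by move=> x y lt /=; rewrite ltn_add2l; apply: enum_val_increasing.
- move=> x; rewrite codom_enum_val inE; apply/idP/codomP => [|[y ->]].
    case: (split_ordP x) => y ->; first by rewrite hL /= eq_sym (negPf kc).
    rewrite hR /= => gy; have [|z <-] := @enum_val_ex _ (fiber g k) y.
      by rewrite inE.
    by exists z.
  by rewrite hR /=; have := enum_valP y; rewrite inE.
- by move=> x; rewrite enum_val_restr_inv // => y; rewrite fiber_inv.
- move=> x; rewrite cat_permR enum_val_restr_inv // => z.
  by rewrite fiber_inv.
Qed.

End ConvolutionValues.

(** * Genus *)

Lemma ordS_val m (i : 'I_m) : ordS i = (if i.+1 == m then 0 else i.+1) :> nat.
Proof.
rewrite /=; case: eqP => [->|]; first by rewrite modnn.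
by move=> /eqP ne; rewrite modn_small // ltn_neqAle ne ltn_ord.
Qed.

Lemma long_cycle_val m (i : 'I_m) :
  long_cycle m i = (if i.+1 == m then 0 else i.+1) :> nat.
Proof. by rewrite permE ordS_val. Qed.

Lemma restr_long_cycle m (p : 'I_m) :
  restr (long_cycle m) [set~ p] = long_cycle #|[set~ p]|.
Proof.
case: m p => [[]//|m] p.
have E : Sperm (restr (long_cycle m.+1) [set~ p]) = Sperm (long_cycle m).
  apply: (@sperm_eq_of_copies m.+1 _ _ _ _ (@enum_val _ (mem [set~ p]))
            (fun x : 'I_m => lift p x)
            (del (long_cycle m.+1) p)).
  - exact: enum_val_increasing.
  - move=> x y; rewrite /= /bump.
    by case: (leqP p x) => ?; case: (leqP p y) => ? /=; lia.
  - move=> x; rewrite codom_enum_val !inE; apply/idP/codomP => [np|[y ->]].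
      by have [|y -> _] := @unlift_some _ p x; rewrite 1?eq_sym //; exists y.
    by rewrite eq_sym neq_lift.
  - exact: enum_val_restr1.
  - move=> x; apply: ord_inj; rewrite /del -val_eqE [LHS]/= /bump long_cycle_val.
    rewrite (fun_if val) /= !long_cycle_val /= /bump.
    have := ltn_ord x; have := ltn_ord p.
    by repeat case: ifP; lia.
(* Being the long cycle of one's own size is a property on [sperm], hence transported along [E]
   without casts. *)
have : (fun s : sperm => tagged s = long_cycle (tag s)) (Sperm (long_cycle m)) by [].
by rewrite -E.
Qed.

(* Up to inversion the Kreweras complement; its cycles are the boundary
   components of the ribbon graph of [a] glued to the disk bounded by
   [1, 2, ..., m]. *)
Definition kreweras m (a : 'S_m) : 'S_m := (a^-1 * long_cycle m)%g.

Definition faces m (a : 'S_m) : nat := ncycles (kreweras a).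

(** The complement of [c] is characterized by [c] followed by it being the long cycle, and the long
    cycle with a point deleted is again a long cycle. *)
Lemma kreweras_restr m (c d : 'S_m) p :
  (forall x, x != p -> del d p (del c p x) = del (long_cycle m) p x) ->
  kreweras (restr c [set~ p]) = restr d [set~ p].
Proof.
move=> H; apply/permP => i.
rewrite -(permKV (restr c [set~ p]) i); move: ((restr c [set~ p])^-1 i)%g => j.
rewrite permM permK -restr_long_cycle; apply: (@enum_val_inj _ (mem [set~ p])).
rewrite !enum_val_restr1 H //.
by have := enum_valP j; rewrite !inE.
Qed.

Section Genus.
Variables (m : nat) (a : 'S_m) (l l' : 'I_m).
Hypothesis el : l' = l.+1 :> nat.
Let tau := tperm l l'.

Lemma long_cycle_adj : long_cycle m l = l'.
Proof.
by apply: ord_inj; rewrite long_cycle_val -el; have := ltn_ord l'; case: eqP; lia.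
Qed.

Lemma long_cycle_eq x : (long_cycle m x == l') = (x == l).
Proof. by rewrite -long_cycle_adj (inj_eq perm_inj). Qed.

Lemma kreweras_app x : kreweras a (a x) = long_cycle m x.
Proof. by rewrite permM permK. Qed.

Lemma kreweras_beta : a l != l' ->
  kreweras (restr (tau * a)%g [set~ l']) = restr (kreweras a) [set~ l'].
Proof.
move=> al; have ll' := adjacent_neq el.
apply: kreweras_restr => x xl'; rewrite [in X in del _ _ X]/del !permM.
have [ex|xl] := eqVneq x l.
  rewrite ex /tau tpermL tpermR; case: eqP => [e|ne].
    have e2 : kreweras a (a l) = l' by rewrite kreweras_app long_cycle_adj.
    by rewrite /del e2 eqxx long_cycle_adj eqxx -{1}e kreweras_app.
  rewrite /del kreweras_app !long_cycle_eq eqxx.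
  by rewrite eq_sym (negPf ll').
have -> : tau x = x by rewrite /tau tpermD // eq_sym.
rewrite /tau tpermR; case: eqP => [e|/eqP ne].
  have e2 : kreweras a (a l) = l' by rewrite kreweras_app long_cycle_adj.
  by rewrite /del e2 eqxx long_cycle_eq (negPf xl) -{1}e kreweras_app.
by rewrite /del kreweras_app long_cycle_eq (negPf xl).
Qed.

(** The complement of the left side is that of [a] with [l'] deleted. It fixes [l'] only if
    [a l = l'], so no face is lost. *)
Lemma faces_beta : a l != l' ->
  faces (restr (tau * a)%g [set~ l']) = faces a.
Proof.
move=> al; rewrite /faces kreweras_beta // ncycles_del // permM long_cycle_eq.
by apply: contra al => /eqP <-; rewrite permKV.
Qed.

(** Here [l'] is a fixed point of the complement, a face by itself that disappears with [l']. *)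
Lemma faces_twin : a l = l' -> faces a = (faces (restr a [set~ l'])).+1.
Proof.
move=> al; have ll' := adjacent_neq el.
have fix_l' : kreweras a l' = l' by rewrite -{1}al kreweras_app long_cycle_adj.
rewrite /faces (ncycles_del_fixed fix_l'); congr (ncycles _).+1.
apply/esym/kreweras_restr => x xl'; rewrite [in X in del _ _ X]/del -al (inj_eq perm_inj).
case: eqP => [->|/eqP xl]; rewrite /del kreweras_app al !long_cycle_eq.
  by rewrite eqxx eq_sym (negPf ll').
by rewrite (negPf xl).
Qed.

(** [tau] maps the complement of [l] increasingly onto the complement of [l']. *)
Lemma restr_tpermJ_del (c : 'S_m) :
  Sperm (restr (tau * c * tau)%g [set~ l']) = Sperm (restr c [set~ l]).
Proof.
apply: (@sperm_eq_of_copies m _ _ _ _ (@enum_val _ (mem [set~ l']))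
  (fun x => tau (@enum_val _ (mem [set~ l]) x)) (del (tau * c * tau)%g l')).
- exact: enum_val_increasing.
- move=> x y /(@enum_val_increasing _ [set~ l]); apply: tperm_lt => //.
  by have := enum_valP x; rewrite !inE => /negPf->.
- move=> x; rewrite codom_enum_val !inE; apply/idP/codomP => [np|[y ->]].
    have [|y ey] := @enum_val_ex _ [set~ l] (tau x).
      by rewrite !inE -(tpermR l l') (inj_eq perm_inj).
    by exists y; rewrite ey tpermK.
  by rewrite -(tpermL l l') (inj_eq perm_inj); have := enum_valP y; rewrite !inE.
- exact: enum_val_restr1.
- move=> x; rewrite enum_val_restr1 /del !permM tpermK tpermR.
  rewrite -{1}(tpermL l l') (inj_eq perm_inj).
  by case: ifP.
Qed.

End Genus.

(** Nonnegativity of the genus, by induction using the first two points. If [a l = l'], deleting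
    [l'] costs one face and no cycle; otherwise multiplying by the transposition and deleting [l']
    keeps the faces and costs at most one cycle. *)
Lemma leq_ncycles_faces m (a : 'S_m) : (ncycles a + faces a <= m.+1)%N.
Proof.
elim/ltn_ind: m a => m IH a.
have [le1|lt1] := leqP m 1.
  by have := leq_ncycles a; have := leq_ncycles (kreweras a); rewrite -/(faces a); lia.
pose l : 'I_m := Ordinal (ltnW lt1); pose l' : 'I_m := Ordinal lt1.
have el : l' = l.+1 :> nat by [].
have IHd (c : 'S_#|[set~ l']|) : (ncycles c + faces c <= m)%N.
  apply: leq_trans (IH _ (eq_leq (card_del l')) c) _; exact: eq_leq (card_del l').
have [al|al] := eqVneq (a l) l'.
  rewrite (faces_twin el al) -(@ncycles_del _ a l'); first by rewrite addnS ltnS.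
  by rewrite -{2}al (inj_eq perm_inj) eq_sym.
have := IHd (restr (tperm l l' * a)%g [set~ l']).
rewrite (faces_beta el al) (ncycles_beta1 al).
by have := ncycles_tpermL a (adjacent_neq el); lia.
Qed.

(** The term [(0 < m)] makes the empty permutation, with no cycles and no faces, planar; otherwise
    the bound [m + 1] is attained. *)
Definition planar m (a : 'S_m) : bool := (ncycles a + faces a == m + (0 < m))%N.

Lemma planar_del m (p q : 'I_m) (c : 'S_#|[set~ p]|) : p != q ->
  planar c = (ncycles c + faces c == m)%N.
Proof.
move=> pq; rewrite /planar; congr (_ == _).
have c0 : (0 < #|[set~ p]|)%N by apply/card_gt0P; exists q; rewrite !inE eq_sym.
by rewrite c0 addn1; apply: card_del.
Qed.

Lemma planar_pos m (a : 'S_m) (l : 'I_m) :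
  planar a = (ncycles a + faces a == m.+1)%N.
Proof. by rewrite /planar (leq_ltn_trans (leq0n l) (ltn_ord l)) addn1. Qed.

Section PlanarSwap.
Variables (m : nat) (a : 'S_m) (l l' : 'I_m).
Hypothesis el : l' = l.+1 :> nat.
Let tau := tperm l l'.

Lemma planar_merge : l' \notin porbit a l ->
  planar a = planar (restr (tau * a)%g [set~ l']).
Proof.
move=> d; have al : a l != l' by apply: contraNneq d => <-; apply: mem_porbit1.
rewrite (planar_pos a l) (@planar_del _ l' l) 1?eq_sym ?(adjacent_neq el) //.
by rewrite (faces_beta el al) (ncycles_beta1 al) -(ncycles_merge d) addSn eqSS.
Qed.

(** The transposition splits the cycle, so the deleted permutation has one cycle more than [a], as
    many faces and one point less: genus 0 for [a] would violate the genus inequality there. *)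
Lemma planar_split : l' \in porbit a l -> a l != l' -> planar a = false.
Proof.
move=> s al; rewrite (planar_pos a l); apply/negP => /eqP e.
have := leq_ncycles_faces (restr (tau * a)%g [set~ l']).
rewrite (faces_beta el al) (ncycles_beta1 al) (ncycles_split (adjacent_neq el) s) addSn e.
by move=> /leq_trans/(_ (eq_leq (card_del l'))); rewrite ltnNge leqnSn.
Qed.

Lemma planar_twin : a l = l' -> planar a = planar (restr a [set~ l']).
Proof.
move=> al; rewrite (planar_pos a l) (@planar_del _ l' l) 1?eq_sym ?(adjacent_neq el) //.
rewrite (faces_twin el al) ncycles_del ?addnS ?eqSS //.
by rewrite -{2}al (inj_eq perm_inj) eq_sym (adjacent_neq el).
Qed.

End PlanarSwap.

(** For distinct cycles, [a] is planar iff the first correction is, and the swapped permutation iff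
    the second is, so the rule telescopes. In one cycle without adjacency both sides vanish. In the
    adjacent case [a] is not planar, and the swapped permutation sends [l] to [l'] and reduces to
    [a] without [l]. *)
Lemma planar_swap_rec (A : nzRingType) : swap_rec (fun m a => (@planar m a)%:R : A).
Proof.
have nadj m (a : 'S_m) (l l' : 'I_m) : a l' != l -> (tperm l l' * a * tperm l l')%g l != l'.
  move=> n; rewrite !permM tpermL; apply: contra n => /eqP e.
  by rewrite -(tpermK l l' (a l')) e tpermR.
have sameJ m (a : 'S_m) (l l' : 'I_m) : l' \in porbit a l ->
    l' \in porbit (tperm l l' * a * tperm l l')%g l.
  move=> s; have := porbit_conj a (tperm l l') l'.
  rewrite conjgE tpermV mulgA tpermR => ->.
  by rewrite -{1}(tpermL l l') imset_f // porbit_sym.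
split=> m a l l' el.
- move=> d; rewrite [in LHS](planar_merge el d).
  set a' := (tperm l l' * a * tperm l l')%g.
  have d' : l' \notin porbit a' l.
    apply: contra d => /sameJ; rewrite /a' !mulgA tperm2 mul1g -mulgA tperm2 mulg1.
    by [].
  rewrite (planar_merge el d').
  have -> : planar (restr (tperm l l' * a')%g [set~ l'])
          = planar (restr (tperm l l' * a)%g [set~ l]).
    rewrite /a' mulgA; apply: (@sperm_congr _ planar); exact: restr_tpermJ_del.
  by rewrite addrAC subrr add0r.
- move=> s n1 n2; rewrite (planar_split el s n1) (planar_split el) //.
    exact: sameJ.
  exact: nadj.
- move=> n1 n2; have s : l' \in porbit a l by rewrite porbit_sym -{1}n2 mem_porbit1.
  rewrite (planar_split el s n1) (planar_twin el); last first.
    by rewrite !permM tpermL n2 tpermL.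
  by rewrite (sperm_congr planar (restr_tpermJ_del el a)) subrr.
Qed.

Lemma del_lift m (a : 'S_m.+1) (p : 'I_m.+1) (c : 'S_m) :
  (forall x, lift p (c x) = del a p (lift p x)) ->
  Sperm (restr a [set~ p]) = Sperm c.
Proof.
move=> H; apply: (@sperm_eq_of_copies m.+1 _ _ _ _ (@enum_val _ (mem [set~ p]))
            (fun x : 'I_m => lift p x) (del a p)).
- exact: enum_val_increasing.
- move=> x y; rewrite /= /bump.
  by case: (leqP p x) => ?; case: (leqP p y) => ? /=; lia.
- move=> x; rewrite codom_enum_val !inE; apply/idP/codomP => [np|[y ->]].
    by have [|y -> _] := @unlift_some _ p x; rewrite 1?eq_sym //; exists y.
  by rewrite eq_sym neq_lift.
- exact: enum_val_restr1.
- exact: H.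
Qed.

Lemma ncycles_pos m (a : 'S_m) : (0 < m)%N -> (0 < ncycles a)%N.
Proof.
by move=> m0; apply/card_gt0P; exists (porbit a (Ordinal m0)); apply: imset_f.
Qed.

(** Merging the new fixed point with the first point of [b] and deleting the latter gives [b] back;
    for empty [b] the cycles and faces are counted directly. *)
Lemma planar_cat_fixed n (b : 'S_n) : planar (cat_perm (long_cycle 1) b) = planar b.
Proof.
case: n b => [|n] b.
  rewrite /planar ncycles_cat ncycles_long_cycle.
  have := leq_ncycles b; have := leq_ncycles (kreweras b); rewrite -/(faces b).
  set a := cat_perm _ _; have := leq_ncycles (kreweras a); rewrite -/(faces a).
  by have : (0 < faces a)%N by [apply: ncycles_pos]; lia.
set a := cat_perm _ _; pose l : 'I_(1 + n.+1) := lshift n.+1 ord0.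
pose l' : 'I_(1 + n.+1) := rshift 1 ord0.
have al : a l = l by rewrite cat_permL; apply: ord_inj; rewrite /= long_cycle_val.
have d : l' \notin porbit a l.
  apply/negP => /porbitP[k]; have -> : (a ^+ k)%g l = l.
    by elim: k => [|k IH]; rewrite ?expg0 ?perm1 // expgSr permM IH.
  by move=> /(congr1 val).
rewrite (@planar_merge _ a l l' erefl d).
apply: (sperm_congr planar); apply: (@del_lift n.+1) => x.
have aR y : a (rshift 1 y) = rshift 1 (b y) by rewrite cat_permR.
have R y : rshift 1 y == l' = (y == ord0) by rewrite /l' (inj_eq (@rshift_inj 1 _)).
rewrite /del !permM tpermR.
have [->|x0] := eqVneq x ord0.
  have -> : lift l' ord0 = l by apply: ord_inj.
  rewrite tpermL al -/(rshift 1 ord0 : 'I_(1 + n.+1)) aR R.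
  case: eqP => [->|/eqP b0]; apply: ord_inj => //=.
  by rewrite /bump /=; case: (b ord0) b0 => [[]].
have -> : lift l' x = rshift 1 x.
  by apply: ord_inj; rewrite /= /bump; case: x x0 => [[]].
have -> : tperm l l' (rshift 1 x) = rshift 1 x by rewrite tpermD // eq_sym ?R.
rewrite aR R al; case: eqP => [->|/eqP b0]; apply: ord_inj => //=.
by rewrite /bump /=; case: (b x) b0 => [[]].
Qed.

(** The standard cycle sends its first point to the second, so [planar_twin] shortens it down to a
    fixed point. *)
Lemma planar_cat_cycle j n (b : 'S_n) :
  planar (cat_perm (long_cycle j.+1) b) = planar b.
Proof.
elim: j => [|j <-]; first exact: planar_cat_fixed.
set a := cat_perm (long_cycle j.+2) b; set c := cat_perm _ b.
pose l : 'I_(j.+2 + n) := lshift n ord0.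
pose l' : 'I_(j.+2 + n) := lshift n (lift ord0 ord0).
have al : a l = l'.
  by rewrite cat_permL; congr lshift; apply: ord_inj; rewrite long_cycle_val.
rewrite (@planar_twin _ a l l' erefl al).
apply: (sperm_congr planar); apply: (@del_lift (j.+1 + n)) => x.
have -> : del a l' (lift l' x) = if x == ord0 then a l' else a (lift l' x).
  rewrite /del -al (inj_eq perm_inj) al; congr (if _ then _ else _).
  by rewrite -!val_eqE /= /bump; case: (val x) => [|[]].
case: (split_ordP x) => y ->.
  rewrite cat_permL; case: eqP => [e|ne]; apply: ord_inj.
    have -> : y = ord0 by apply: ord_inj; have := congr1 val e.
    rewrite /a cat_permL /= !long_cycle_val /= /bump.
    by case: (j).
  have -> : lift l' (lshift n y) = lshift n (lift ord0 y).
    have y0 : val y != 0%N by apply/eqP => e; apply: ne; apply: ord_inj.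
    by apply: ord_inj; rewrite /= /bump lt0n y0.
  rewrite cat_permL /= !long_cycle_val /= /bump.
  by have := ltn_ord y; case: ifP; case: ifP; lia.
rewrite cat_permR; case: eqP => [/(congr1 val)//|_].
have -> : lift l' (rshift j.+1 y) = rshift j.+2 y by apply: ord_inj; rewrite /= /bump.
by rewrite cat_permR; apply: ord_inj; rewrite /= /bump.
Qed.

(** * Planar positive permutations *)

Lemma mem_porbit_app (T : finType) (a : {perm T}) x u :
  (a u \in porbit a x) = (u \in porbit a x).
Proof.
have := porbit_perm a 1 u; rewrite expg1 => E.
by rewrite porbit_sym E porbit_sym.
Qed.

(** A non-ascent is the maximum of its cycle: each cycle rises from its minimum to its maximum and
    then returns, which is the cyclewise form of positivity. *)
Definition standard m (a : 'S_m) : Prop :=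
  forall x y : 'I_m, y \in porbit a x -> (a x <= x)%N -> (y <= x)%N.

Lemma porbit_max m (a : 'S_m) x : exists2 M, M \in porbit a x &
  forall y, y \in porbit a x -> (y <= M)%N.
Proof.
by case: (@arg_maxnP _ x (mem (porbit a x)) val (porbit_id a x)) => M; exists M.
Qed.

(** Positivity says that there are as many non-ascents as cycles. Each cycle has one, its maximum,
    so it has no other. *)
Lemma positive_standard m (a : 'S_m) : positive a -> standard a.
Proof.
move=> /eqP pos; pose D := [set i : 'I_m | (a i <= i)%N].
have cD : #|D| = #|porbits a|.
  have := cardsC [set i : 'I_m | (i < a i)%N]; rewrite -/(ascents a) card_ord pos.
  have -> : ~: [set i : 'I_m | (i < a i)%N] = D.
    by apply/setP => i; rewrite !inE -leqNgt.
  by have := leq_ncycles a; rewrite /ncycles; lia.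
have injD : {in D &, injective (porbit a)}.
  apply/imset_injP; rewrite eqn_leq leq_imset_card /= cD.
  apply: subset_leq_card; apply/subsetP => A /imsetP[x _ ->].
  have [M Mx maxM] := porbit_max a x; apply/imsetP; exists M.
    by rewrite inE maxM // mem_porbit_app.
  by apply/eqP; rewrite eq_porbit_mem porbit_sym.
move=> x y yx ax; have [M Mx maxM] := porbit_max a x.
have -> : x = M; last exact: maxM.
apply: injD; rewrite ?inE //; first by rewrite maxM // mem_porbit_app.
by apply/eqP; rewrite eq_porbit_mem porbit_sym.
Qed.

(** Let [z] be the least point of the cycle above [x] and [u] its predecessor. If [u] is a
    non-ascent, it is the maximum, hence [z] is the minimum, contradicting [x < z]. Otherwise
    [u < x < z = a u], a gap of the same kind at a smaller point. *)
Lemma standard_gap m (a : 'S_m) (x y : 'I_m) : standard a -> y \in porbit a x ->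
  ~~ ((x < y)%N && (y < a x)%N).
Proof.
move=> std; have [n] := ubnP (val x); elim: n x y => // n IH x y lt_n yx.
apply/negP => /andP[xy yax].
have [z /andP[zx xz] minz] :=
  @arg_minnP _ y (fun z => (z \in porbit a x) && (x < z)%N) val (introT andP (conj yx xy)).
have z_le_y : (z <= y)%N by apply: minz; rewrite yx.
pose u := (a^-1)%g z; have au : a u = z by rewrite permKV.
have ux : u \in porbit a x.
  by rewrite -mem_porbit_app au.
have [nasc|asc] := leqP (a u) u.
  have umax v : v \in porbit a x -> (v <= u)%N.
    move=> vx; apply: (std u v _ nasc).
    by rewrite (@porbit_trans _ _ _ x) // porbit_sym.
  have [mn mnx minmn] := @arg_minnP _ x (mem (porbit a x)) val (porbit_id a x).
  pose v := (a^-1)%g mn; have av : a v = mn by rewrite permKV.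
  have vx : v \in porbit a x.
    by rewrite -mem_porbit_app av.
  have uv : (u <= v)%N.
    apply: (std v u); last by rewrite av; apply: minmn.
    by rewrite (@porbit_trans _ _ _ x) // porbit_sym.
  have e : u = v by apply: ord_inj; apply/eqP; rewrite eqn_leq uv umax.
  have := minmn x (porbit_id a x); rewrite -av -e au /=; lia.
have nu : (u <= x)%N.
  by rewrite leqNgt; apply/negP => xu; have := minz u; rewrite ux xu -au => /(_ isT) /=; lia.
have ne : u != x by apply: contraTneq yax => <-; rewrite au -leqNgt.
have lt_ux : (u < x)%N by rewrite ltn_neqAle ne.
have xu : x \in porbit a u by rewrite porbit_sym.
by have := IH u x (leq_trans lt_ux lt_n) xu; rewrite lt_ux au xz.
Qed.

Definition noncrossing m (a : 'S_m) : Prop :=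
  forall x y x' y' : 'I_m, (x < y)%N -> (y < x')%N -> (x' < y')%N ->
    x' \in porbit a x -> y' \in porbit a y -> y \in porbit a x.

Section DeletePoint.
Variables (m : nat) (a : 'S_m) (p : 'I_m).
Let c := restr a [set~ p].
Let e := @enum_val _ (mem [set~ p]).

Lemma e_lt i j : (e i < e j)%N = (i < j)%N.
Proof. exact: enum_val_lt. Qed.

Lemma e_le i j : (e i <= e j)%N = (i <= j)%N.
Proof. by rewrite leqNgt e_lt -leqNgt. Qed.

Hypothesis twin_or_fixed : a p = p \/ exists2 l : 'I_m, p = l.+1 :> nat & a l = p.

(** The only new arrow runs from [l = p - 1] to [a p]. If it does not ascend, [p] was the maximum of
    its cycle, and after its deletion [l] is. *)
Lemma standard_del : standard a -> standard c.
Proof.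
move=> std i j ji; rewrite -!e_le {1}/e enum_val_restr1 -/(e i) /del.
have ji' : e j \in porbit a (e i) by rewrite -porbit_restr.
case: eqP => [eip|_ ai]; last exact: (std _ _ ji' ai).
case: twin_or_fixed => [ap|[l el al]].
  have := enum_valP i; rewrite !inE -/(e i).
  by rewrite (perm_inj (etrans eip (esym ap))) eqxx.
have -> : e i = l by apply: (@perm_inj _ a); rewrite eip.
move=> apl; have jp : (e j <= p)%N.
  apply: std; last by rewrite el ltnW.
  by rewrite (porbit_trans _ ji') // porbit_sym -eip mem_porbit1.
have : e j != p by have := enum_valP j; rewrite !inE.
by rewrite -val_eqE /= el; move: jp; rewrite el; lia.
Qed.

(** A crossing through [p] can be moved off [p]: a fixed point takes part in no crossing, and
    otherwise the preceding point [l] of the same cycle replaces [p]. *)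
Lemma noncrossing_del : noncrossing a <-> noncrossing c.
Proof.
split=> nc x y x' y' xy yx' x'y' xx' yy'.
  rewrite porbit_restr; apply: (nc _ _ (e x') (e y')); rewrite ?e_lt //.
    by rewrite -porbit_restr.
  by rewrite -porbit_restr.
apply: contraT => nyx.
(* [r] is the identity if [p] is fixed and otherwise sends [p] to [l]. It respects cycles and the
   strict order between points of different cycles, which is all that a crossing involves. *)
have [r [rp rorb rlt]] : exists r : 'I_m -> 'I_m,
   [/\ forall z, z \in [:: x; y; x'; y'] -> r z != p,
       forall z, r z \in porbit a z &
       forall z z', z' \notin porbit a z -> (z < z')%N -> (r z < r z')%N].
  case: twin_or_fixed => [ap|[l el al]].
    exists id; split=> // z; first last.
      by apply: porbit_id.
    have fx u : u \in porbit a p -> u = p.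
      move=> /porbitP[k ->].
      by elim: k => [|k IH]; rewrite ?expg0 ?perm1 // expgSr permM IH.
    rewrite !inE => /or4P[] /eqP ->; apply/eqP => ep.
    - by move: xx'; rewrite ep => /fx h; move: xy; rewrite ep; move: yx'; rewrite h; lia.
    - by move: yy'; rewrite ep => /fx h; move: yx'; rewrite ep; move: x'y'; rewrite h; lia.
    - move: xx'; rewrite porbit_sym ep => /fx h.
      by move: yx'; rewrite ep; move: xy; rewrite h; lia.
    - move: yy'; rewrite porbit_sym ep => /fx h.
      by move: x'y'; rewrite ep; move: yx'; rewrite h; lia.
  exists (fun z => if z == p then l else z); split=> [z _|z|z z' nzz'].
  - by have [_|//] := eqVneq z p; apply/eqP => h; move: el; rewrite h; lia.
  - by case: eqP => [->|_]; rewrite ?porbit_id // porbit_sym -al mem_porbit1.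
  - case: eqP => [ez|/eqP nz]; case: eqP => [ez'|/eqP nz'] //.
    + by rewrite ez ez' ltnn.
    + by rewrite ez el; lia.
    + have zl : z != l by apply: contraNneq nzz' => ->; rewrite ez' -al mem_porbit1.
      by move: zl; rewrite ez' el -val_eqE /=; lia.
have lift z : z \in [:: x; y; x'; y'] -> exists i, e i = r z.
  by move=> /rp h; apply: enum_val_ex; rewrite !inE.
have [i ei] : exists i, e i = r x by apply: lift; rewrite !inE eqxx.
have [j ej] : exists i, e i = r y by apply: lift; rewrite !inE eqxx !orbT.
have [i' ei'] : exists i, e i = r x' by apply: lift; rewrite !inE eqxx !orbT.
have [j' ej'] : exists i, e i = r y' by apply: lift; rewrite !inE eqxx !orbT.
have rP z : porbit a (r z) = porbit a z by apply/eqP; rewrite eq_porbit_mem.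
move: xx' yy' nyx; rewrite -!eq_porbit_mem => /eqP xx' /eqP yy' nyx.
have := nc i j i' j'; rewrite -!e_lt !porbit_restr -/e -/(e i) -/(e j) -/(e i') -/(e j').
rewrite ei ej ei' ej' -!eq_porbit_mem !rP xx' yy' !eqxx => H.
rewrite -(negbTE nyx); apply: H => //; apply: rlt => //.
all: by rewrite -eq_porbit_mem ?xx' ?yy' // eq_sym.
Qed.

End DeletePoint.

(** [planar_merge] is applied to [p] and its predecessor, or its successor when [p] is the first
    point; absorbing a fixed point amounts to deleting it. *)
Lemma planar_fixed m (a : 'S_m) (p : 'I_m) : (1 < m)%N -> a p = p ->
  planar a = planar (restr a [set~ p]).
Proof.
move=> m1 ap; have fx u : u \in porbit a p -> u = p.
  move=> /porbitP[k ->].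
  by elim: k => [|k IH]; rewrite ?expg0 ?perm1 // expgSr permM IH.
case: (posnP p) => [p0|p_gt0].
  pose l' := Ordinal m1; have el : l' = p.+1 :> nat by rewrite p0.
  have pl' : p != l' := adjacent_neq el.
  have d : l' \notin porbit a p by apply: contra pl' => /fx->.
  rewrite (planar_merge el d); apply: (sperm_congr planar).
  rewrite -(restr_tpermJ_del el); apply: (restr_eq (F := del (tperm p l' * a)%g l')) => // i.
    exact: enum_val_restr1.
  rewrite enum_val_restr1; have := enum_valP i; rewrite !inE.
  move: (enum_val i) => x xl'; rewrite /del !permM tpermR ap tpermL.
  have [->|xp] := eqVneq x p.
    rewrite tpermL; have [->|n1] := eqVneq (a l') l'.
      by rewrite tpermR (negPf pl').
    rewrite tpermD ?(negPf n1) // eq_sym //.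
    by rewrite -{1}ap (inj_eq perm_inj) eq_sym.
  have -> : tperm p l' x = x by rewrite tpermD // eq_sym.
  have axp : a x != p by rewrite -{1}ap (inj_eq perm_inj).
  have [->|n1] := eqVneq (a x) l'; first by rewrite tpermR (negPf pl').
  by rewrite tpermD ?(negPf n1) // eq_sym.
have lt_l : (p.-1 < m)%N by have := ltn_ord p; lia.
pose l := Ordinal lt_l; have el : p = l.+1 :> nat by rewrite /= prednK.
have d : p \notin porbit a l.
  by rewrite porbit_sym; apply: contra (adjacent_neq el) => /fx->.
rewrite (planar_merge el d); apply: (sperm_congr planar).
apply: (restr_eq (F := del a p)) => // i; last exact: enum_val_restr1.
rewrite enum_val_restr1; have := enum_valP i; rewrite !inE.
move: (enum_val i) => x xp; rewrite /del !permM tpermR ap.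
have [->|xl] := eqVneq x l.
  by rewrite tpermL ap eqxx; case: eqP.
have -> : tperm l p x = x by rewrite tpermD // eq_sym.
by have /negPf-> : a x != p by rewrite -{1}ap (inj_eq perm_inj).
Qed.

(** Weigh fixed points by 2 and other points by 1: every cycle then has weight at least 2. *)
Lemma ncycles_fixpoints m (a : 'S_m) :
  (2 * ncycles a <= m + #|[set x | a x == x]|)%N.
Proof.
have -> : (m + #|[set x | a x == x]| = \sum_(x : 'I_m) (1 + (a x == x)))%N.
  rewrite big_split /= sum1_card card_ord; congr addn.
  by rewrite -sum1dep_card big_mkcond; apply: eq_bigr => x _; case: eqP.
rewrite (partition_big_imset (porbit a)) /= mulnC -sum_nat_const.
apply: leq_sum => A /imsetP[x _ ->].
rewrite (bigD1 x) ?eqxx //=; have [//|nx] := eqVneq (a x) x.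
rewrite (bigD1 (a x)) /=; first by lia.
rewrite nx andbT eq_porbit_mem mem_porbit1 //.
Qed.

(** Without fixed points [2 c <= m]. The complement has at most one fixed point, so its number F of
    cycles satisfies [2 F <= m + 1], and [c + F] cannot reach [m + 1]. *)
Lemma irreducible_not_planar m (a : 'S_m) : (0 < m)%N ->
  (forall x, a x != x) -> (forall l l' : 'I_m, l' = l.+1 :> nat -> a l != l') ->
  planar a = false.
Proof.
move=> m0 nofix notwin; apply/negbTE/negP => /eqP; rewrite m0 addn1 => e.
have := ncycles_fixpoints a; have := ncycles_fixpoints (kreweras a).
rewrite -/(faces a) (_ : [set x | a x == x] = finset.set0) ?cards0; last first.
  by apply/setP => x; rewrite !inE (negPf (nofix x)).
(* A fixed point of the complement is a pair of cyclically consecutive points joined by [a]; only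
   the wrap-around to 0 is not excluded by [notwin]. *)
have : (#|[set x | kreweras a x == x]| <= 1)%N; last by lia.
rewrite -(cards1 (Ordinal m0)); apply: subset_leq_card; apply/subsetP => y.
rewrite !inE -{1 2}(permKV a y) kreweras_app => /eqP h.
have := notwin (a^-1 y)%g y; rewrite permKV eqxx.
have := congr1 val h; rewrite /= permKV long_cycle_val; case: eqP => [_ y0 _|_ hy].
  by apply/eqP/ord_inj.
by move=> /(_ (esym hy)).
Qed.

(** Take a shortest ascent [x < a x]. The point [y = x + 1] lies strictly inside it, hence in
    another cycle. By minimality of the ascent [a y] falls outside the interval from [x] to [a x],
    and the two arrows cross. *)
Lemma irreducible_crossing m (a : 'S_m) : (0 < m)%N -> standard a ->
  (forall x, a x != x) -> (forall l l' : 'I_m, l' = l.+1 :> nat -> a l != l') ->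
  ~ noncrossing a.
Proof.
move=> m0 std nofix notwin nc; pose o : 'I_m := Ordinal m0.
have asc_o : (o < a o)%N.
  by rewrite lt0n; apply: contra (nofix o) => /eqP h; apply/eqP/ord_inj.
have [x asc min_x] := @arg_minnP _ o (fun x => (x < a x)%N) (fun x => a x - x)%N asc_o.
have lt_y : (x.+1 < m)%N by have := ltn_ord (a x); lia.
pose y := Ordinal lt_y; have ey : y = x.+1 :> nat by [].
have yax : (y < a x)%N.
  rewrite ltn_neqAle asc andbT; apply: contra (notwin x y ey) => /eqP h.
  by apply/eqP/ord_inj.
have xy : (x < y)%N by rewrite ey.
have nyx : y \notin porbit a x.
  by apply/negP => /(standard_gap std); rewrite xy yax.
have := nofix y; rewrite -val_eqE /= neq_ltn => /orP[ayy|yay].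
  have nax : val (a y) != x.
    by apply: contra nyx => /eqP/ord_inj h; rewrite -mem_porbit_app h porbit_id.
  have ayx : (a y < x)%N by rewrite ltn_neqAle nax; move: ayy; rewrite ltnS.
  have yy : y \in porbit a (a y) by rewrite porbit_sym mem_porbit1.
  have := nc _ _ _ _ ayx xy yax yy (mem_porbit1 a x).
  by rewrite porbit_sym mem_porbit_app (negPf nyx).
case: (ltngtP (a x) (a y)) => [lt|lt|].
- have := nc x y (a x) (a y) xy yax lt; rewrite !mem_porbit1 => /(_ isT isT).
  by rewrite (negPf nyx).
- have := min_x y; rewrite ey yay => /(_ isT); lia.
- by move=> /ord_inj/perm_inj h; move: xy; rewrite h ltnn.
Qed.

(** Deleting a fixed point or the second point of a pair [a l = l + 1] changes neither side. Once
    there are none left and [m > 1], both sides fail. *)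
Lemma planarP m (a : 'S_m) : standard a -> planar a <-> noncrossing a.
Proof.
elim/ltn_ind: m a => m IH a std.
have [m1|m1] := leqP m 1.
  split=> _.
    by move=> x y x' y' xy yx'; have := ltn_ord x'; lia.
  rewrite /planar; case: m {IH std} a m1 => [|[|//]] a _.
    have := leq_ncycles a; have := leq_ncycles (kreweras a).
    by rewrite -/(faces a) !leqn0 => /eqP-> /eqP->.
  have := leq_ncycles a; have := leq_ncycles (kreweras a).
  have := @ncycles_pos _ a isT; have := @ncycles_pos _ (kreweras a) isT.
  by rewrite -/(faces a); lia.
have IHd p : (a p = p \/ exists2 l : 'I_m, p = l.+1 :> nat & a l = p) ->
    planar (restr a [set~ p]) <-> noncrossing a.
  move=> h; rewrite (noncrossing_del h); apply: IH; last exact: standard_del.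
  exact: eq_leq (card_del p).
have [/existsP[p /eqP ap]|/existsPn nofix] := boolP [exists p, a p == p].
  by rewrite (planar_fixed m1 ap); apply: IHd; left.
have [/existsP[l /existsP[l' /andP[/eqP el /eqP al]]]|notwin] :=
    boolP [exists l : 'I_m, exists l' : 'I_m, (val l' == l.+1) && (a l == l')].
  by rewrite (planar_twin el al); apply: IHd; right; exists l.
have notwin' (l l' : 'I_m) : l' = l.+1 :> nat -> a l != l'.
  move=> el; apply: contra notwin => al; apply/existsP; exists l.
  by apply/existsP; exists l'; rewrite -el eqxx.
have m0 := ltnW m1; rewrite (irreducible_not_planar m0 nofix notwin').
by split=> // /(irreducible_crossing m0 std nofix notwin').
Qed.

Lemma standard_restr m (a : 'S_m) (U : {set 'I_m}) :
  (forall y, (a y \in U) = (y \in U)) -> standard a -> standard (restr a U).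
Proof.
move=> aU std i j; rewrite porbit_restr => ji h.
rewrite leqNgt -(enum_val_lt i j) -leqNgt; apply: std => //.
by rewrite -(enum_val_restr_inv _ aU) leqNgt enum_val_lt -leqNgt.
Qed.

Lemma noncrossing_restr m (a : 'S_m) (U : {set 'I_m}) :
  noncrossing (restr a U) <->
  (forall x y x' y' : 'I_m, x \in U -> y \in U -> x' \in U -> y' \in U ->
     (x < y)%N -> (y < x')%N -> (x' < y')%N ->
     x' \in porbit a x -> y' \in porbit a y -> y \in porbit a x).
Proof.
split=> nc; last first.
  move=> i j i' j' h1 h2 h3; rewrite !porbit_restr.
  by apply: nc; rewrite ?enum_valP ?enum_val_lt.
move=> x y x' y' /enum_val_ex[i <-] /enum_val_ex[j <-] /enum_val_ex[i' <-].
move=> /enum_val_ex[j' <-]; rewrite !enum_val_lt -!porbit_restr; exact: nc.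
Qed.

(** * Planar color classes and proper colorings *)

Section Colorings.
Variables (m : nat) (a : 'S_m) (n : nat).

Lemma mem_porbits (x : 'I_m) : porbit a x \in porbits a.
Proof. exact: imset_f. Qed.

Definition cycle_at (x : 'I_m) : cycle_of a := exist _ (porbit a x) (mem_porbits x).

Definition spread (g : {ffun cycle_of a -> 'I_n}) : {ffun 'I_m -> 'I_n} :=
  [ffun x => g (cycle_at x)].

Lemma cycle_atP (A : cycle_of a) : exists x, A = cycle_at x.
Proof.
by case: A => A hA; have /imsetP[x _ eA] := hA; exists x; apply: val_inj.
Qed.

Lemma spread_inj : injective spread.
Proof.
move=> g h e; apply/ffunP => A; have [x ->] := cycle_atP A.
by have := congr1 (fun f : {ffun 'I_m -> 'I_n} => f x) e; rewrite !ffunE.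
Qed.

Lemma cycle_at_eq x y : y \in porbit a x -> cycle_at y = cycle_at x.
Proof. by move=> yx; apply: val_inj; apply/eqP; rewrite eq_porbit_mem. Qed.

Lemma spread_cycle_inv g : cycle_inv a (spread g).
Proof.
by apply/cycle_invP => x; rewrite !ffunE (@cycle_at_eq x) // mem_porbit1.
Qed.

Lemma cycle_inv_spread (f : {ffun 'I_m -> 'I_n}) : cycle_inv a f -> exists g, f = spread g.
Proof.
move=> fa; have ex (A : cycle_of a) : exists x, A == cycle_at x.
  by have [x ->] := cycle_atP A; exists x.
exists [ffun A => f (xchoose (ex A))]; apply/ffunP => x; rewrite !ffunE.
apply: (cycle_inv_porbit fa); have /eqP/(congr1 val)/= e := xchooseP (ex (cycle_at x)).
by rewrite -eq_porbit_mem e.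
Qed.

(** A crossing of distinct cycles inside a color class is the same as a monochromatic edge of the
    intersection graph. *)
Lemma spread_proper g :
  (forall k, noncrossing (restr a (fiber (spread g) k))) <->
  g \in proper_colorings (@intersection_graph m a) n.
Proof.
rewrite inE; split=> [nc|/forallP pr k].
  apply/forallP => A; apply/forallP => B; apply/implyP => /andP[].
  have [x0 ->] := cycle_atP A; have [y0 ->] := cycle_atP B => nAB int.
  apply: contra nAB => /eqP eg; rewrite -val_eqE /= eq_porbit_mem.
  have ncg := (noncrossing_restr _ _).1 (nc (g (cycle_at x0))).
  have inF z : (z \in porbit a x0) || (z \in porbit a y0) ->
      z \in fiber (spread g) (g (cycle_at x0)).
    by rewrite inE ffunE => /orP[] /cycle_at_eq ->; rewrite ?eg.
  case/exists_inP: int => x xA /exists_inP[x' x'A] /exists_inP[y yB].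
  case/exists_inP => y' y'B int.
  have [hx hx' hy hy'] : [/\ x \in fiber (spread g) (g (cycle_at x0)),
      x' \in fiber (spread g) (g (cycle_at x0)),
      y \in fiber (spread g) (g (cycle_at x0)) &
      y' \in fiber (spread g) (g (cycle_at x0))].
    by split; apply: inF; rewrite ?xA ?x'A ?yB ?y'B ?orbT.
  move: xA x'A yB y'B; rewrite /= -!eq_porbit_mem => /eqP xA /eqP x'A /eqP yB /eqP y'B.
  case/orP: int => /and3P[h1 h2 h3].
    have := ncg x y x' y' hx hy hx' hy' h1 h2 h3.
    by rewrite -!eq_porbit_mem xA x'A yB y'B !eqxx eq_sym => /(_ isT isT).
  have := ncg y x y' x' hy hx hy' hx' h1 h2 h3.
  by rewrite -!eq_porbit_mem xA x'A yB y'B !eqxx => /(_ isT isT).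
apply/noncrossing_restr => x y x' y'; rewrite !inE !ffunE.
move=> /eqP gx /eqP gy _ _ h1 h2 h3 xx' yy'; apply: contraT => nyx.
have := forallP (pr (cycle_at x)) (cycle_at y); rewrite gx gy eqxx implybF.
case/negP; apply/andP; split.
  by rewrite -val_eqE /= eq_sym eq_porbit_mem.
apply/exists_inP; exists x; first exact: porbit_id.
apply/exists_inP; exists x' => //.
apply/exists_inP; exists y; first exact: porbit_id.
by apply/exists_inP; exists y' => //; rewrite h1 h2 h3.
Qed.

(** The product of the indicators over the colors is 1 when all color classes are planar, that is,
    noncrossing, and 0 otherwise; the sum counts the proper colorings. *)
Lemma conv_planar (A : comNzRingType) : standard a ->
  conv (fun (_ : 'I_n) m (b : 'S_m) => (planar b)%:R : A) a =
  #|proper_colorings (@intersection_graph m a) n|%:R.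
Proof.
move=> std; rewrite -(card_imset _ spread_inj) -sum1_card natr_sum.
rewrite /conv big_mkcond [RHS]big_mkcond /=; apply: eq_bigr => f _.
have [fa|nfa] := boolP (cycle_inv a f); last first.
  case: imsetP => // -[g _ ef]; by rewrite ef spread_cycle_inv in nfa.
have planarE k : planar (restr a (fiber f k)) <-> noncrossing (restr a (fiber f k)).
  by apply/planarP/standard_restr => // y; rewrite fiber_inv.
have [g ef] := cycle_inv_spread fa; rewrite /colored.
have [/forallP all|] := boolP [forall k, planar (restr a (fiber f k))].
  rewrite big1 => [|k _]; last by rewrite all.
  rewrite ef imset_f //; apply/spread_proper => k; rewrite -ef.
  by apply/planarE.
rewrite negb_forall => /existsP[k nk]; rewrite (bigD1 k) //= (negPf nk) mul0r.
case: imsetP => // -[h hpr eh]; case/negP: nk; apply/planarE.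
by rewrite eh; apply: (spread_proper h).2.
Qed.

End Colorings.

(** * Chromatic polynomials *)

(** Every cycle consists of two points, exactly one of which is an ascent, so there are [m / 2]
    ascents and [m / 2] cycles. *)
Lemma chord_diagram_positive m (a : 'S_m) : chord_diagram a -> positive a.
Proof.
move=> /forallP chord; have aa i : a (a i) = i by have /andP[/eqP] := chord i.
have an i : a i != i by have /andP[] := chord i.
have orb x y : y \in porbit a x -> y = x \/ y = a x.
  move=> /porbitP[k ->]; elim: k => [|k [] IH]; first by left; rewrite expg0 perm1.
    by right; rewrite expgSr permM IH.
  by left; rewrite expgSr permM IH aa.
pose U := [set i : 'I_m | (i < a i)%N].
have injU : {in U &, injective (porbit a)}.
  move=> i j; rewrite !inE => hi hj /eqP; rewrite eq_porbit_mem => /orb[//|ei].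
  by move: hi; rewrite ei aa; lia.
have eU : porbits a = porbit a @: U.
  apply/setP => A; apply/imsetP/imsetP => -[x _ ->]; last by exists x.
  have := an x; rewrite -val_eqE /= neq_ltn => /orP[h|h]; last by exists x; rewrite ?inE.
  exists (a x); first by rewrite inE aa.
  by apply/eqP; rewrite eq_porbit_mem porbit_sym mem_porbit1.
have cU : #|~: U| = #|U|.
  rewrite -(card_imset _ (@perm_inj _ a)); apply: eq_card => x.
  apply/imsetP/idP => [[y yU ->]|].
    rewrite inE aa; move: yU; rewrite !inE -leqNgt leq_eqVlt => /orP[|//].
    by have := an y; rewrite -val_eqE => /negPf->.
  rewrite inE => h; exists (a x); last by rewrite aa.
  by rewrite !inE aa -leqNgt ltnW.
rewrite /positive eU card_in_imset // -/(ascents a).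
have := cardsC U; rewrite card_ord cU /ascents -/U; lia.
Qed.

Section Chromatic.
Variables (K : fieldType) (w : weight_system K).
Hypothesis w_gl : is_wgl w.

Let subst_n n (f : cpoly K) : K := horner_eval n%:R (subst_x f).

Let subst_n_additive n : additive (subst_n n).
Proof. by move=> f g; rewrite /subst_n /subst_x !rmorphB. Qed.

HB.instance Definition _ n := GRing.isAdditive.Build _ _ (subst_n n) (subst_n_additive n).

Lemma planar_empty (a : 'S_0) : planar a.
Proof.
have := leq_ncycles a; have := leq_ncycles (kreweras a).
by rewrite /planar /faces !leqn0 => /eqP-> /eqP->.
Qed.

(** Both sides obey the swap rules. A standard cycle contributes n on either side: the value of its
    variable, and one planar indicator for each of the n colors. *)
Lemma subst_n_X0 n m (a : 'S_m) :
  subst_n n (X0 w a) = conv (fun (_ : 'I_n) m (b : 'S_m) => (planar b)%:R : K) a.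
Proof.
move: m a; apply: swap_rec_unique.
- exact: swap_rec_raddf (X0_swap_rec w_gl).
- by apply: conv_swap_rec => k; apply: planar_swap_rec.
- move=> a; rewrite (X0_empty w_gl) conv_empty => [|k b]; last by rewrite planar_empty.
  by rewrite /subst_n /subst_x !rmorph1.
- move=> k p b e; rewrite (@conv_cat_cycle _ _ _ (fun _ => 1)); last first.
    by move=> c i d; rewrite planar_cat_cycle mul1r.
  rewrite sumr_const card_ord -e (X0_cat w_gl) (X0_cycle w_gl).
  by rewrite /subst_n /subst_x !rmorphM /= peval_pvar /horner_eval hornerX.
Qed.

Lemma positive_chromatic m (a : 'S_m) : positive a ->
  is_chromatic_poly (@intersection_graph m a) (subst_x (Xcoef w 0 a)).
Proof.
move=> /positive_standard std n; rewrite Xcoef0E -conv_planar //.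
exact: subst_n_X0.
Qed.

End Chromatic.

(** * Bialgebra structure *)

Section LinearExtension.
Variable K : fieldType.

Section LinExt.
Variables (M : choiceType) (V : lmodType K) (f : M -> V).

Lemma lin_extEw (d : {fset M}) (a : {malg K[M]}) :
  (msupp a `<=` d)%fset -> lin_ext f a = \sum_(c <- d) a@_c *: f c.
Proof.
move=> le; rewrite /lin_ext (big_fset_incl _ le) // => c _ /mcoeff_outdom ->.
by rewrite scale0r.
Qed.

Lemma lin_ext_linear : linear (lin_ext f).
Proof.
move=> k a b; pose d := (msupp (k *: a + b) `|` msupp a `|` msupp b)%fset.
rewrite !(@lin_extEw d) /d; first last.
- by rewrite -fsetUA fsubsetUl.
- by rewrite fsetUAC fsubsetUr.
- exact: fsubsetUr.
rewrite scaler_sumr -big_split /=; apply: eq_bigr => c _.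
by rewrite mcoeffD mcoeffZ scalerDl scalerA.
Qed.

HB.instance Definition _ :=
  GRing.isLinear.Build K {malg K[M]} V *:%R (lin_ext f) lin_ext_linear.

Lemma lin_extU c : lin_ext f << c >> = f c.
Proof. by rewrite /lin_ext msuppU oner_eq0 big_seq_fset1 mcoeffUU scale1r. Qed.

End LinExt.

Lemma malg_sumZ (M : choiceType) (a : {malg K[M]}) :
  a = \sum_(c <- msupp a) a@_c *: << c >>.
Proof.
rewrite {1}[a]monalgE; apply: eq_bigr => c _; apply/malgP => x.
by rewrite mcoeffZ !mcoeffU mulr_natr.
Qed.

End LinearExtension.

Section BasisProduct.
Variables (K : fieldType) (M : monomType).

Lemma malgU_mul (x y : M) : (<< x >> * << y >> : {malg K[M]}) = << mmul x y >>.
Proof. by rewrite malgM_def fgmulUU mulr1. Qed.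

Lemma malgU_one : (1 : {malg K[M]}) = << mone >>.
Proof. by rewrite -mpolyC1E. Qed.

End BasisProduct.

Section Tensor.
Variables (K : fieldType) (M1 M2 : conomType).

Definition inl_mon (x : M1) : {malg K[(M1 * M2)%type]} := << (x, mone) >>.
Definition inr_mon (y : M2) : {malg K[(M1 * M2)%type]} := << (mone, y) >>.

Lemma inl_mon_mmorphism : mmorphism inl_mon.
Proof.
split=> [x y|]; last by rewrite /inl_mon malgU_one.
by rewrite /inl_mon malgU_mul; congr << _ >>; congr pair; rewrite /= mul1m.
Qed.

Lemma inr_mon_mmorphism : mmorphism inr_mon.
Proof.
split=> [x y|]; last by rewrite /inr_mon malgU_one.
by rewrite /inr_mon malgU_mul; congr << _ >>; congr pair; rewrite /= mul1m.
Qed.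

HB.instance Definition _ := isMultiplicative.Build M1 _ inl_mon inl_mon_mmorphism.
HB.instance Definition _ := isMultiplicative.Build M2 _ inr_mon inr_mon_mmorphism.

Definition inl_tens : {malg K[M1]} -> {malg K[(M1 * M2)%type]} :=
  mmap (@malgC (M1 * M2)%type K) inl_mon.
Definition inr_tens : {malg K[M2]} -> {malg K[(M1 * M2)%type]} :=
  mmap (@malgC (M1 * M2)%type K) inr_mon.

HB.instance Definition _ := GRing.RMorphism.on inl_tens.
HB.instance Definition _ := GRing.RMorphism.on inr_tens.

(** Expresses tensors as products of values of two ring morphisms, so that convolution with two
    colors computes in the tensor square. *)
Lemma tensE a b : tens a b = inl_tens a * inr_tens b.
Proof.
rewrite /tens /inl_tens /inr_tens /mmap mulr_suml; apply: eq_bigr => x _.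
rewrite mulr_sumr; apply: eq_bigr => y _.
rewrite !mul_malgC -scalerAl -scalerAr scalerA /inl_mon /inr_mon malgU_mul.
apply/malgP => z; rewrite mcoeffZ !mcoeffU /pair_mul /mmul /= mulr_natr.
by congr (_ *+ (_ == z)); congr pair; rewrite ?mulm1 ?mul1m.
Qed.

Lemma tensl1 a : tens a 1 = inl_tens a.
Proof. by rewrite tensE rmorph1 mulr1. Qed.

Lemma tens1r b : tens 1 b = inr_tens b.
Proof. by rewrite tensE rmorph1 mul1r. Qed.

End Tensor.

(** * The filtration by weighted degree *)

Section Filtration.
Variable K : fieldType.

Lemma wdegEw (d : {fset nat}) (mon : {cmonom nat}) :
  (finsupp mon `<=` d)%fset -> wdeg mon = (\sum_(i <- d) mon i * i.+1)%N.
Proof.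
move=> le; rewrite /wdeg (big_fset_incl _ le) // => i _.
by rewrite -cmE_neq0 negbK => /eqP->.
Qed.

Lemma wdegM (x y : {cmonom nat}) : wdeg (mmul x y) = (wdeg x + wdeg y)%N.
Proof.
rewrite (@wdegEw _ x (fsubsetUl _ (finsupp y))) (@wdegEw _ y (fsubsetUr (finsupp x) _)).
rewrite /wdeg mdomD -big_split /=; apply: eq_bigr => i _.
by rewrite cmM mulnDl.
Qed.

Lemma wdegU k : wdeg (ucm k) = k.+1.
Proof. by rewrite /wdeg mdomU big_seq_fset1 cmUU mul1n. Qed.

Implicit Types f g : cpoly K.

Lemma cpoly_filt_le n p f : (n <= p)%N -> cpoly_filt n f -> cpoly_filt p f.
Proof. by move=> le h mon /h/leq_trans; apply. Qed.

Lemma cpoly_filtB n f g : cpoly_filt n f -> cpoly_filt n g -> cpoly_filt n (f - g).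
Proof. by move=> hf hg mon /(fsubsetP (msuppB_le _ _)); rewrite in_fsetU => /orP[/hf|/hg]. Qed.

Lemma cpoly_filtD n f g : cpoly_filt n f -> cpoly_filt n g -> cpoly_filt n (f + g).
Proof. by move=> hf hg mon /(fsubsetP (msuppD_le _ _)); rewrite in_fsetU => /orP[/hf|/hg]. Qed.

Lemma cpoly_filtZ n k f : cpoly_filt n f -> cpoly_filt n (k *: f).
Proof. by move=> hf mon /(fsubsetP (msuppZ_le _ _))/hf. Qed.

Lemma cpoly_filt0 n : cpoly_filt n (0 : cpoly K).
Proof. by move=> mon; rewrite msupp0. Qed.

Lemma cpoly_filt_pvarM n k f : cpoly_filt n f -> cpoly_filt (k.+1 + n) (pvar K k * f).
Proof.
move=> hf mon /msuppM_le [x [y [hx /hf hy ->]]]; rewrite wdegM leq_add //.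
by move: hx; rewrite msuppU1 in_fset1 => /eqP->; rewrite wdegU.
Qed.

End Filtration.

Lemma malg_scaleMM (K : fieldType) (M : conomType) (k j : K) (x y : {malg K[M]}) :
  (k *: x) * (j *: y) = (k * j) *: (x * y).
Proof. by rewrite -scalerAl -scalerAr scalerA. Qed.

Section HopfHom.
Variables (K : fieldType) (w : weight_system K).
Hypothesis w_gl : is_wgl w.
Let X0 := X0 w.

(** The corrections live on [m - 1] points, hence in a lower filtration step, and a standard cycle
    contributes a variable whose weight is its length. *)
Lemma X0_filt m (a : 'S_m) : cpoly_filt m (X0 a).
Proof.
move: m a; apply: swap_ind => [a|k n b IH|m a l l' el al IH].
- rewrite /X0 (X0_empty w_gl) => mon.
  by rewrite malgU_one msuppU1 in_fset1 => /eqP->; rewrite /wdeg mdom1 big_seq_fset0.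
- by rewrite /X0 (X0_cat w_gl) (X0_cycle w_gl); apply: cpoly_filt_pvarM.
have IHd (c : 'S_m) p : cpoly_filt m (X0 (restr c [set~ p])).
  apply: (@cpoly_filt_le _ #|[set~ p]|).
    by rewrite -ltnS ltnW // ltnS; exact: eq_leq (card_del p).
  by apply: IH; exact: eq_leq (card_del p).
suff [d hd E] : exists2 d, cpoly_filt m d &
    X0 a = X0 (tperm l l' * a * tperm l l')%g + d.
  split=> h; first by rewrite -[X0 _](addrK d) -E; apply: cpoly_filtB.
  by rewrite E; apply: cpoly_filtD.
have R := X0_swap_rec w_gl.
have [adj|nadj] := eqVneq (a l') l.
  exists (0 - X0 (restr a [set~ l])); first by apply: cpoly_filtB; [apply: cpoly_filt0|].
  by rewrite /X0 (swap_rec_adj R el al adj) sub0r.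
have [s|d] := boolP (l' \in porbit a l).
  exists 0; first exact: cpoly_filt0.
  by rewrite /X0 (swap_rec_same R el s al nadj) addr0.
exists (X0 (restr (tperm l l' * a)%g [set~ l']) - X0 (restr (tperm l l' * a)%g [set~ l])).
  exact: cpoly_filtB.
by rewrite /X0 (swap_rec_diff R el d) addrA.
Qed.

(** The indicator of [m = 0] also obeys the rules: both deletions have the same size, and in the
    adjacent case a point remains. On a standard cycle the constant term vanishes. *)
Lemma X0_counit m (a : 'S_m) : counit (X0 a) = (m == 0%N)%:R.
Proof.
move: m a; apply: (@swap_rec_unique _ (fun m a => (X0 a)@_mone) (fun m _ => (m == 0%N)%:R)).
- exact: (@swap_rec_raddf _ _ (@mcoeff {cmonom nat} K mone) _ (X0_swap_rec w_gl)).
- split=> m a l l' el; first 2 last.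
  + have ne : (#|([set~ l] : {set 'I_m})| == 0)%N = false.
      apply/negbTE; rewrite -lt0n; apply/card_gt0P; exists l'.
      by rewrite !inE eq_sym (adjacent_neq el).
    by rewrite ne subr0.
  + move=> _; have e : #|([set~ l] : {set 'I_m})| = #|([set~ l'] : {set 'I_m})|.
      by rewrite !cardsC1.
    by rewrite e addrK.
  + by [].
- by move=> a; rewrite /X0 (X0_empty w_gl) eqxx mcoeff1 eqxx.
- move=> k n b _; rewrite /X0 (X0_cat w_gl) (X0_cycle w_gl).
  by rewrite rmorphM /= mcoeffU1 cm1_eq1 mul0r.
Qed.

Lemma X0_map_linear : linear (X0_map w).
Proof. exact: lin_ext_linear. Qed.

HB.instance Definition _ :=
  GRing.isLinear.Build K (rotalg K) (cpoly K) *:%R (X0_map w) X0_map_linear.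

Lemma X0_mapZ k a : X0_map w (k *: a) = k *: X0_map w a.
Proof. exact: linearZ. Qed.

Lemma X0_mapU c : X0_map w << c >> = X0 (tagged (repr c)).
Proof. by rewrite /X0_map lin_extU Xcoef0E. Qed.

Lemma X0_map_mmul c d :
  X0_map w << mmul c d >> = X0_map w << c >> * X0_map w << d >>.
Proof.
rewrite -[mmul c d]/(rclass (cat_perm (tagged (repr c)) (tagged (repr d)))).
by rewrite (X0_mapE w_gl) Xcoef0E (X0_cat w_gl) !X0_mapU.
Qed.

Lemma X0_map_mulZ k j c d :
  X0_map w ((k *: << c >>) * (j *: << d >>)) =
  X0_map w (k *: << c >>) * X0_map w (j *: << d >>).
Proof.
rewrite malg_scaleMM malgU_mul.
transitivity ((k * j) *: X0_map w << mmul c d >>). exact: X0_mapZ.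
rewrite X0_map_mmul.
transitivity ((k *: X0_map w << c >>) * (j *: X0_map w << d >>)).
  symmetry. exact: malg_scaleMM.
congr (_ * _); symmetry. exact: X0_mapZ.
exact: X0_mapZ.
Qed.

Lemma X0_mapM a b : X0_map w (a * b) = X0_map w a * X0_map w b.
Proof.
rewrite [a]malg_sumZ [b]malg_sumZ mulr_suml !linear_sum mulr_suml.
apply: eq_bigr => c _; rewrite mulr_sumr linear_sum [RHS]mulr_sumr.
apply: eq_bigr => d _.
exact: X0_map_mulZ.
Qed.

Lemma X0_map1 : X0_map w 1 = 1.
Proof. by rewrite malgU_one (X0_mapE w_gl) Xcoef0E (X0_empty w_gl). Qed.

Lemma rone_tag c : (tag (repr c) == 0%N) = (c == rone).
Proof.
apply/eqP/eqP => [e|->]; last first.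
  by have := rot_equiv_tag (rot_equiv_repr sempty).
have -> : c = (\pi_rotclass (repr c))%qT by rewrite reprK.
have -> // : repr c = sempty.
by case: (repr c) e => [m a] /= em; subst m; apply: spermP => //= -[].
Qed.

Lemma X0_map_counit a : counit (X0_map w a) = counit a.
Proof.
rewrite /counit /X0_map /lin_ext raddf_sum /= [in RHS](malg_sumZ a) raddf_sum.
apply: eq_bigr => c _; rewrite /= !mcoeffZ mcoeffU1 -rone_tag Xcoef0E.
by congr (_ * _); apply: X0_counit.
Qed.

Lemma X0_map_filt n a : rotalg_filt n a -> cpoly_filt n (X0_map w a).
Proof.
move=> ha; rewrite /X0_map /lin_ext big_seq; apply: (big_ind (@cpoly_filt K n)).
- exact: cpoly_filt0.
- exact: cpoly_filtD.
move=> c /ha hc; apply: cpoly_filtZ; rewrite Xcoef0E.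
exact: (cpoly_filt_le hc (@X0_filt _ _)).
Qed.

End HopfHom.

(** * Compatibility with the comultiplications *)

Section Comultiplication.
Variables (K : fieldType) (w : weight_system K).
Hypothesis w_gl : is_wgl w.

Let mono2 : conomType := ({cmonom nat} * {cmonom nat})%type.
Local Notation inl := (@inl_tens K {cmonom nat} {cmonom nat}).
Local Notation inr := (@inr_tens K {cmonom nat} {cmonom nat}).

Let phi (c : bool) m (a : 'S_m) : {malg K[mono2]} :=
  if c then inl (X0 w a) else inr (X0 w a).

Let comul : cpoly K -> {malg K[mono2]} :=
  peval (@malgC mono2 K) (fun k => tens 1 (pvar K k) + tens (pvar K k) 1).

HB.instance Definition _ := GRing.RMorphism.on comul.

(** Uniqueness for the swap rules: on a standard cycle, primitivity of the variable matches the sum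
    over the two colors, [true] for the left tensor factor and [false] for the right one. *)
Lemma comul_X0_conv m (a : 'S_m) : comul (X0 w a) = conv phi a.
Proof.
move: m a; apply: swap_rec_unique.
- exact: swap_rec_raddf (X0_swap_rec w_gl).
- apply: conv_swap_rec => -[]; exact: swap_rec_raddf (X0_swap_rec w_gl).
- move=> a; rewrite (X0_empty w_gl) rmorph1 conv_empty // => c b.
  by rewrite /phi (X0_empty w_gl); case: c; rewrite rmorph1.
- move=> k n b e.
  rewrite (@conv_cat_cycle _ _ _
    (fun c : bool => if c then inl (pvar K k) else inr (pvar K k))); last first.
    by move=> c i d; rewrite /phi (X0_cat w_gl) (X0_cycle w_gl); case: c; rewrite rmorphM.
  rewrite big_bool -e (X0_cat w_gl) (X0_cycle w_gl) rmorphM; congr (_ * _).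
  transitivity (tens 1 (pvar K k) + tens (pvar K k) 1); first exact: peval_pvar.
  by rewrite [LHS]addrC; congr (_ + _); [apply: tensl1 | apply: tens1r].
Qed.

(** A coloring of the cycles by two colors is the same as the set [I] of cycles colored [true]. *)
Lemma conv_subsets m (a : 'S_m) :
  conv phi a = \sum_(I in powerset (porbits a))
    tens (X0 w (restr a (cover I))) (X0 w (restr a (cover (porbits a :\: I)))).
Proof.
pose h (I : {set {set 'I_m}}) := [ffun x => porbit a x \in I].
pose h' (f : {ffun 'I_m -> bool}) := [set porbit a x | x in [set x | f x]].
have h'h (I : {set {set 'I_m}}) : I \subset porbits a -> h' (h I) = I.
  move=> /subsetP sI; apply/setP => A; apply/imsetP/idP => [[x]|AI].
    by rewrite inE ffunE => ? ->.
  by have /imsetP[x _ eA] := sI _ AI; exists x; rewrite // inE ffunE -eA.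
rewrite /conv (reindex_onto h h'); last first.
  move=> f fa; apply/ffunP => x; rewrite ffunE; apply/imsetP/idP => [[y]|fx].
    rewrite inE => fy /eqP; rewrite eq_porbit_mem => xy.
    by rewrite (cycle_inv_porbit fa xy).
  by exists x; rewrite ?inE.
have porb x : porbit a (a x) = porbit a x.
  by apply/eqP; rewrite eq_porbit_mem mem_porbit1.
apply: eq_big => [I|I].
  rewrite powersetE; apply/andP/idP => [[_ /eqP <-]|sI].
    by apply/subsetP => A /imsetP[x _ ->]; apply: imset_f.
  by rewrite h'h // eqxx; split=> //; apply/cycle_invP => x; rewrite !ffunE porb.
case/andP => _ /eqP hI; have /subsetP sI : I \subset porbits a.
  by rewrite -hI; apply/subsetP => A /imsetP[x _ ->]; apply: imset_f.
have coverE (J : {set {set 'I_m}}) x : {subset J <= porbits a} ->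
    (x \in cover J) = (porbit a x \in J).
  move=> sJ; apply/bigcupP/idP => [[A AJ]|]; last by exists (porbit a x) => //; apply: porbit_id.
  have /imsetP[y _ eA] := sJ _ AJ.
  by rewrite eA -eq_porbit_mem => /eqP->; rewrite -eA.
have fT : fiber (h I) true = cover I.
  by apply/setP => x; rewrite inE ffunE eqb_id coverE.
have fF : fiber (h I) false = cover (porbits a :\: I).
  apply/setP => x; rewrite inE ffunE eqbF_neg coverE => [|A]; last by case/setDP.
  by rewrite in_setD imset_f // andbT.
by rewrite /colored big_bool fT fF tensE.
Qed.

Lemma X0_comul m (a : 'S_m) :
  cpoly_comul (X0 w a) = \sum_(I in powerset (porbits a))
    tens (X0 w (restr a (cover I))) (X0 w (restr a (cover (porbits a :\: I)))).
Proof. by rewrite -conv_subsets -comul_X0_conv. Qed.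

Lemma cpoly_comul_lin_comb (I : Type) (r : seq I) (k : I -> K) (f : I -> cpoly K) :
  cpoly_comul (\sum_(i <- r) k i *: f i) = \sum_(i <- r) k i *: cpoly_comul (f i).
Proof.
rewrite -![cpoly_comul _]/(comul _) rmorph_sum; apply: eq_bigr => i _.
rewrite -[in LHS]mul_malgC rmorphM /= /comul pevalC.
exact: mul_malgC.
Qed.

Lemma tens_map_perm_comul m (a : 'S_m) :
  tens_map (X0_map w) (X0_map w) (perm_comul K a) = cpoly_comul (X0 w a).
Proof.
rewrite X0_comul /perm_comul /tens_map linear_sum; apply: eq_bigr => I _.
by rewrite /= lin_extU /= !(X0_mapE w_gl) !Xcoef0E.
Qed.

Lemma X0_map_comul (a : rotalg K) :
  tens_map (X0_map w) (X0_map w) (rotalg_comul a) = cpoly_comul (X0_map w a).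
Proof.
rewrite [X0_map w a]/lin_ext cpoly_comul_lin_comb.
rewrite [rotalg_comul a]/lin_ext /tens_map linear_sum; apply: eq_bigr => c _.
by rewrite linearZ; congr (_ *: _); rewrite Xcoef0E; apply: tens_map_perm_comul.
Qed.

End Comultiplication.

(** The identities hold on the whole algebra and therefore restrict to each [H]. *)
Lemma X0_map_filtered_hopf_hom (K : fieldType) (w : weight_system K)
    (H : rotalg K -> Prop) :
  is_wgl w -> filtered_hopf_hom_on H (X0_map w).
Proof.
move=> w_gl; split=> [k a b _ _||a b _ _|a _|a _|n a _].
- exact: X0_map_linear.
- exact: X0_map1.
- exact: X0_mapM.
- exact: X0_map_counit.
- exact: X0_map_comul.
- exact: X0_map_filt.
Qed.

Theorem corollary3p3 (R : realType) (w : weight_system R[i]) (w_gl : is_wgl w) :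
  [/\ filtered_hopf_hom_on (@rotalg_pos R[i]) (X0_map w),
      filtered_hopf_hom_on (@rotalg_chord R[i]) (X0_map w),
      (forall (m : nat) (a : 'S_m), positive a ->
         is_chromatic_poly (@intersection_graph m a) (subst_x (Xcoef w 0 a)))
    & (forall (m : nat) (a : 'S_m), chord_diagram a ->
         is_chromatic_poly (@intersection_graph m a) (subst_x (Xcoef w 0 a)))].
Proof.
split; try exact: X0_map_filtered_hopf_hom.
  by move=> m a; apply: positive_chromatic.
by move=> m a /chord_diagram_positive; apply: positive_chromatic.
Qed.
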